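(* For every integer $n\ge 0$ (both even and odd), the total volume of the double hyperbolic space $\mathbb{DH}^n$ is $$V_n(\mathbb{DH}^n)=i^n\,V_n(\mathbb{S}^n),$$ where $i=\sqrt{-1}$ and $V_n(\mathbb{S}^n)$ is the $n$-dimensional volume of the standard unit $n$-sphere $\mathbb{S}^n$ (with $V_0(\mathbb{S}^0)=2$).
   Context: **Double hyperbolic space.** Put $x\cdot y=-x_0y_0+x_1y_1+\cdots+x_ny_n$ on $\mathbb{R}^{n+1}$. Let $\mathbb{H}^n=\{x: x\cdot x=-1,\ x_0>0\}$ with length element $ds=(-dx_0^2+dx_1^2+\cdots+dx_n^2)^{1/2}$, and $\mathbb{H}^n_-=\{x: x\cdot x=-1,\ x_0<0\}$ with *negative* length element $ds=-(-dx_0^2+dx_1^2+\cdots+dx_n^2)^{1/2}$. $\mathbb{DH}^n$ is obtained by gluing $\mathbb{H}^n$ and $\mathbb{H}^n_-$ along their boundaries at infinity, identified projectively (the future light ray through $p$ is identified with the past light ray through $-p$); the common boundary is denoted $\partial\mathbb{H}^n$. $\mathbb{DH}^0$ consists of two points. An *isometry* of $\mathbb{DH}^n$ is an isometry of $\mathbb{H}^n$ extended to $\mathbb{H}^n_-$ so that antipodal pairs $x,-x$ go to antipodal pairs (and extended to $\partial\mathbb{H}^n$). A *half-space* in $\mathbb{DH}^n$ is a (closed or open) half-space of $\mathbb{H}^n$ together with its antipodal image in $\mathbb{H}^n_-$, glued along their common boundary on $\partial\mathbb{H}^n$. **Upper half-space model.** The map $(x_0,\dots,x_n)\mapsto(1/x_0,x_1/x_0,\dots,x_n/x_0)$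 (extended to the boundary at infinity) identifies $\mathbb{DH}^n$ with the unit sphere in $\mathbb{R}^{n+1}$, and then $(x_0,\dots,x_n)\mapsto\left(\frac{2x_0}{x_n+1},\dots,\frac{2x_{n-1}}{x_n+1}\right)$ identifies it with $\mathbb{R}^n\cup\{\infty\}$ (coordinates $x_0,\dots,x_{n-1}$). Here $\mathbb{H}^n$ is $\{x_0>0\}$, $\mathbb{H}^n_-$ is $\{x_0<0\}$, $\partial\mathbb{H}^n=\{x_0=0\}\cup\{\infty\}$, antipodal points correspond to mirror points with respect to $x_0=0$, and for both signs of $x_0$ the length element is $(dx_0^2+\cdots+dx_{n-1}^2)^{1/2}/x_0$ and the volume element is $dx_0\cdots dx_{n-1}/x_0^n$. Half-spaces are the insides or outsides of balls centered on $\{x_0=0\}$, or Euclidean half-spaces whose bounding hyperplane is perpendicular to $\{x_0=0\}$. **Volume.** Let $\mathcal{H}$ be the algebra of subsets of $\mathbb{DH}^n$ generated by half-spaces. For $n\ge1$ and $P\in\mathcal{H}$ contained in a bounded region of $\mathbb{R}^n$ (upper half-space model), define $$V_n(P)=\lim_{\epsilon\to0^+}\int_P\frac{dx_0\cdots dx_{n-1}}{(x_0-\epsilon i)^n}.$$ This limit exists, is finitely additive, and is invariant under isometries of $\mathbb{DH}^n$. Otherwise map $P$ into a bounded region by an isometry first; if this is impossible (e.g. for $\mathbb{DH}^n$), cut $P$ by a half-space into two pieces for which it is possible and add the values. For $n=0$, $V_0(\mathbb{DH}^0)=2$. *)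

(* Defs.v *)
From HB Require Import structures.
From mathcomp Require Import all_boot all_order all_algebra.
From mathcomp Require Import complex.
From mathcomp Require Import all_classical all_reals all_analysis.

Set Implicit Arguments.
Unset Strict Implicit.
Unset Printing Implicit Defensive.

Import Order.TTheory GRing.Theory Num.Theory.
Import numFieldNormedType.Exports.

Local Open Scope classical_set_scope.
Local Open Scope ring_scope.
Local Open Scope complex_scope.

(** * Lebesgue integration on R^n *)

Definition row_of_tuple (R : realType) (n : nat) (t : n.-tuple R) : 'rV[R]_n :=
  \row_j tnth t j.

Definition tuple_cons (R : realType) (n : nat) (p : R * n.-tuple R) :
    n.+1.-tuple R :=
  [tuple of p.1 :: p.2].

Definition tuple_uncons (R : realType) (n : nat) (t : n.+1.-tuple R) :
    R * n.-tuple R :=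
  (thead t, [tuple of behead t]).

Section lebesgue_step.
Context (R : realType) (n : nat).

Let cons := @tuple_cons R n : measurableTypeR R * n.-tuple (measurableTypeR R) ->
  n.+1.-tuple (measurableTypeR R).
Let uncons := @tuple_uncons R n : n.+1.-tuple (measurableTypeR R) ->
  measurableTypeR R * n.-tuple (measurableTypeR R).

Let measurable_tuple_cons : measurable_fun setT cons.
Proof. exact: measurable_cons. Qed.

Let measurable_tuple_uncons : measurable_fun setT uncons.
Proof.
apply/measurable_fun_pairP; split; first exact: measurable_tnth.
exact: measurable_behead.
Qed.

Variable mu : {sigma_finite_measure set (n.-tuple (measurableTypeR R)) -> \bar R}.

Definition lebesgue_step : set (n.+1.-tuple (measurableTypeR R)) -> \bar R :=
  pushforward (product_measure1 (@lebesgue_measure R) mu) cons.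

Let lebesgue_step0 : lebesgue_step set0 = 0%E.
Proof. exact: measure0. Qed.

Let lebesgue_step_ge0 A : (0 <= lebesgue_step A)%E.
Proof. exact: measure_ge0. Qed.

Let lebesgue_step_sigma_additive : semi_sigma_additive lebesgue_step.
Proof. exact: measure_semi_sigma_additive. Qed.

HB.instance Definition _ := isMeasure.Build _ _ _ lebesgue_step
  lebesgue_step0 lebesgue_step_ge0 lebesgue_step_sigma_additive.

Let lebesgue_step_sigma_finite : sigma_finite setT lebesgue_step.
Proof.
have /sigma_finiteP[F [FT ndF Ffin]] := sigma_finiteT (@lebesgue_measure R).
have /sigma_finiteP[G [GT ndG Gfin]] := sigma_finiteT mu.
have [mF Foo] := all_and2 Ffin; have [mG Goo] := all_and2 Gfin.
exists (fun i => uncons @^-1` (F i `*` G i)).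
  apply/esym; rewrite -subTset => t _; move: (I : [set: R] (uncons t).1).
  rewrite FT => -[i _ Fit]; move: (I : [set: n.-tuple R] (uncons t).2).
  rewrite GT => -[j _ Gjt]; exists (maxn i j) => //; split.
    by move: Fit; exact/subsetPset/ndF/leq_maxl.
  by move: Gjt; exact/subsetPset/ndG/leq_maxr.
move=> i; split.
  by rewrite -[X in measurable X]setTI; apply: measurable_tuple_uncons => //;
     exact: measurableX.
rewrite /lebesgue_step /pushforward -comp_preimage.
rewrite (_ : uncons \o cons = id).
  rewrite preimage_id product_measure1E//.
  apply: lte_mul_pinfty => //; last exact: Goo.
  by rewrite ge0_fin_numE; [exact: Foo|exact: measure_ge0].
by apply/funext => -[x t]; congr pair; exact: val_inj.
Qed.

HB.instance Definition _ := Measure_isSigmaFinite.Build _ _ _ lebesgue_step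
  lebesgue_step_sigma_finite.

End lebesgue_step.

(* Lebesgue measure on R^n, as the iterated product of the Lebesgue measure on
   R along R^(n+1) = R * R^n; R^0 is a point of mass 1. *)
Fixpoint lebesgue_tuple (R : realType) (n : nat) :
    {sigma_finite_measure set (n.-tuple (measurableTypeR R)) -> \bar R} :=
  match n with
  | 0 => \d_([tuple] : 0.-tuple (measurableTypeR R))
  | m.+1 => lebesgue_step (lebesgue_tuple R m)
  end.

Definition complex_integral (R : realType) (n : nat) (D : set (n.-tuple R))
    (f : n.-tuple R -> R[i]) : R[i] :=
  (\int[lebesgue_tuple R n]_(t in D) complex.Re (f t)) +i*
  (\int[lebesgue_tuple R n]_(t in D) complex.Im (f t)).

(** * The volume of the unit sphere *)

(* The n-dimensional volume of a parametrized piece phi : U -> R^m, that is the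
   integral of the square root of the Gram determinant of phi.  With the row
   vector convention the Jacobian is an n x m matrix. *)
Definition parametrized_volume (R : realType) (n m : nat) (U : set 'rV[R]_n)
    (phi : 'rV[R]_n -> 'rV[R]_m) : R :=
  \int[lebesgue_tuple R n]_(t in [set t | U (row_of_tuple t)])
    Num.sqrt (\det (jacobian phi (row_of_tuple t) *m
                    (jacobian phi (row_of_tuple t))^T)).

Definition sqnorm (R : realType) (n : nat) (x : 'rV[R]_n) : R :=
  \sum_(j < n) x 0 j ^+ 2.

Definition hemisphere (R : realType) (n : nat) (s : R) (x : 'rV[R]_n) :
    'rV[R]_n.+1 :=
  row_mx (s * Num.sqrt (1 - sqnorm x))%:M x.

(* The two open hemispheres cover S^n up to the equator, which has no
   n-dimensional volume (and is empty for n = 0). *)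
Definition sphere_volume (R : realType) (n : nat) : R :=
  parametrized_volume [set x : 'rV[R]_n | sqnorm x < 1] (@hemisphere R n 1) +
  parametrized_volume [set x : 'rV[R]_n | sqnorm x < 1] (@hemisphere R n (-1)).

(** * Double hyperbolic space *)

Definition lorentz (R : realType) (n : nat) (x y : 'rV[R]_n.+1) : R :=
  - (x 0 0 * y 0 0) + \sum_(j < n) x 0 (lift ord0 j) * y 0 (lift ord0 j).

Definition hyp (R : realType) (n : nat) : set 'rV[R]_n.+1 :=
  [set x | lorentz x x = -1 /\ 0 < x 0 0].

Definition hyp_neg (R : realType) (n : nat) : set 'rV[R]_n.+1 :=
  [set x | lorentz x x = -1 /\ x 0 0 < 0].

(* A point at infinity is a light line (a future light ray identified with the
   opposite past light ray), represented by its unique vector with x_0 = 1. *)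
Definition hyp_boundary (R : realType) (n : nat) : set 'rV[R]_n.+1 :=
  [set x | lorentz x x = 0 /\ x 0 0 = 1].

Definition DH (R : realType) (n : nat) : set 'rV[R]_n.+1 :=
  @hyp R n `|` @hyp_neg R n `|` @hyp_boundary R n.

(* (x_0, ..., x_n) |-> (1/x_0, x_1/x_0, ..., x_n/x_0), extended by 0 = 1/oo in
   the first coordinate to the points at infinity. *)
Definition to_sphere (R : realType) (n : nat) (x : 'rV[R]_n.+1) :
    'rV[R]_n.+1 :=
  \row_j (if j == 0 then (if lorentz x x == 0 then 0 else (x 0 0)^-1)
          else x 0 j / x 0 0).

Definition arcosh (R : realType) (t : R) : R :=
  ln (t + Num.sqrt (t ^+ 2 - 1)).

(* The distance of the length element of H^n: cosh d(x, y) = - x . y. *)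
Definition hyp_dist (R : realType) (n : nat) (x y : 'rV[R]_n.+1) : R :=
  arcosh (- lorentz x y).

(* Only the values of g on DH matter.  The extension to the points at infinity
   is the one by continuity, the topology of DH being that of the sphere. *)
Definition DH_isometry (R : realType) (n : nat)
    (g : 'rV[R]_n.+1 -> 'rV[R]_n.+1) : Prop :=
  [/\ set_bij (@hyp R n) (@hyp R n) g,
      (forall x y, hyp x -> hyp y -> hyp_dist (g x) (g y) = hyp_dist x y),
      (forall x, hyp x -> g (- x) = - g x),
      (forall p, hyp_boundary p -> hyp_boundary (g p)) &
      (forall (p : 'rV[R]_n.+1) (u : nat -> 'rV[R]_n.+1), hyp_boundary p ->
         (forall k, hyp (u k)) ->
         to_sphere (u k) @[k --> \oo] --> to_sphere p ->
         to_sphere (g (u k)) @[k --> \oo] --> to_sphere (g p))].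

(* The half-space {x . v <= 0} (closed = true) or {x . v < 0} (closed = false)
   of H^n, its antipodal image, and their common boundary at infinity. *)
Definition half_space (R : realType) (n : nat) (closed : bool)
    (v : 'rV[R]_n.+1) : set 'rV[R]_n.+1 :=
  let A := [set x | hyp x /\ lorentz x v < 0 ?<= if closed] in
  A `|` [set - x | x in A] `|`
  [set p | hyp_boundary p /\ lorentz p v < 0 ?<= if closed].

(* v must be spacelike for v^perp to be a hyperplane of H^n. *)
Definition half_spaces (R : realType) (n : nat) : set (set 'rV[R]_n.+1) :=
  [set P | exists closed v, 0 < lorentz v v /\ P = half_space closed v].

(* An algebra of subsets of DH is a ring of subsets of DH to which DH belongs. *)
Definition half_space_algebra (R : realType) (n : nat) :
    set (set 'rV[R]_n.+1) :=
  <<r @half_spaces R n `|` [set @DH R n] >>.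

(** * The upper half-space model *)

Definition at_infinity (R : realType) (n : nat) (x : 'rV[R]_n.+1) : Prop :=
  to_sphere x 0 ord_max = -1.

Definition upper_coord (R : realType) (n : nat) (x : 'rV[R]_n.+1) : 'rV[R]_n :=
  \row_j (2 * to_sphere x 0 (widen_ord (leqnSn n) j) /
          (to_sphere x 0 ord_max + 1)).

Definition upper_bounded (R : realType) (n : nat) (P : set 'rV[R]_n.+1) :
    Prop :=
  (forall x, P x -> ~ at_infinity x) /\
  exists M : R, forall x, P x -> sqnorm (upper_coord x) <= M.

Definition upper_region (R : realType) (n : nat) (P : set 'rV[R]_n.+1) :
    set (n.-tuple R) :=
  [set t | (@upper_coord R n @` P) (row_of_tuple t)].

(** * The volume on DH *)

Definition regularized_integral (R : realType) (n : nat)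
    (P : set 'rV[R]_n.+2) (eps : R) : R[i] :=
  complex_integral (upper_region P)
    (fun t => ((tnth t ord0 -i* eps) ^+ n.+1)^-1).

Definition bounded_volume (R : realType) (n : nat) (P : set 'rV[R]_n.+2)
    (v : R[i]) : Prop :=
  upper_bounded P /\
  (regularized_integral P eps @[eps --> 0^'+] --> (v : (R[i] : numFieldType))).

Definition movable (R : realType) (n : nat) (P : set 'rV[R]_n.+2) : Prop :=
  exists2 g, DH_isometry g & upper_bounded (g @` P).

Definition movable_volume (R : realType) (n : nat) (P : set 'rV[R]_n.+2)
    (v : R[i]) : Prop :=
  bounded_volume P v \/
  (~ upper_bounded P /\ exists2 g, DH_isometry g & bounded_volume (g @` P) v).

(* is_volume P v says that v is a value of V_n(P) obtained by following the
   definition of V_n for some choice of the isometries and of the cutting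
   half-space; that V_n(P) = v means that v is the only such value.  V_0 is the
   number of points. *)
Definition is_volume (R : realType) (n : nat) :
    set 'rV[R]_n.+1 -> R[i] -> Prop :=
  match n with
  | 0 => fun P v =>
      @half_space_algebra R 0 P /\ exists2 k, (P #= `I_k)%card & v = k%:R
  | m.+1 => fun P v =>
      @half_space_algebra R m.+1 P /\
      (movable_volume P v \/
       (~ movable P /\
        exists H v1 v2,
          [/\ @half_spaces R m.+1 H,
              movable_volume (P `&` H) v1,
              movable_volume (P `\` H) v2 &
              v = v1 + v2]))
  end.

(* Main.v *)
Require Import Defs.
From HB Require Import structures.
From mathcomp Require Import all_boot all_order all_algebra.
From mathcomp Require Import complex ring lra.
From mathcomp Require Import all_classical all_reals all_analysis.
From mathcomp Require Import measurable_realfun.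

(** The proof rests on two facts: all half-spaces of DH^n (n >= 1) have the same
    volume, and this volume is i^n times the volume of a hemisphere of S^n.

    Let omega_k be the volume of the unit ball of R^k.  In the upper half-space
    model a bounded half-space is, outside the null hyperplane x_0 = 0, a Euclidean
    ball centred on this hyperplane (upper_region_quadric, quadric_tball).  If its
    radius is r, slicing it by x_0 = r sin x gives omega_(n-1) times the integral
    N(n, n) of (cos x / (sin x - i eps / r))^n over [-pi/2, pi/2]
    (complex_integral_tball).  The limit as eps tends to 0 therefore does not depend
    on the ball.  It is a regularization of the integral of cot^n: integration by
    parts relates N(n, n) to - N(n-2, n-2), up to an error that tends to 0, and
    since N(0, 0) = pi and N(1, 1) tends to i pi, the limit is i^n pi
    (cotint_limit).  A half-space thus has volume i^n pi omega_(n-1).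

    On the sphere, a hemisphere parametrized by the unit ball of R^n has the area
    density 1 / sqrt(1 - |x|^2) (gram_hemisphere), whose integral over every chord
    parallel to the first axis is pi (integral_arcsine).  A hemisphere thus has
    volume pi omega_(n-1) (sphere_volume_ball).

    It remains to see that the choices in the definition of the volume do not
    matter.  DH^n itself cannot be moved into a bounded region, since its images
    contain H^n.  It has to be cut by a half-space, and the complement of a half-space
    is a half-space (DH_setD_half_space).  An isometry preserves the Lorentz
    products of points of H^n, and the normal vector of a half-space is a combination
    of two such points, so the image of a half-space is again a half-space up to
    points at infinity (isometry_half_space).  Hence every choice gives twice the
    volume found above.  Such a choice exists: the half-space x_n >= 0 is bounded,
    and the reflection in x_n maps its complement to a bounded set. *)

Set Implicit Arguments.
Unset Strict Implicit.
Unset Printing Implicit Defensive.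

Import Order.TTheory GRing.Theory Num.Theory.
Import numFieldNormedType.Exports.

Local Open Scope classical_set_scope.
Local Open Scope ring_scope.
Local Open Scope complex_scope.

(** * Complex-valued functions of a real variable *)

Section ComplexCalculus.
Context {R : realType}.
Implicit Types (F G f g : R -> R[i]).
Local Notation C := (R[i] : numFieldType).
Local Notation Re := (@complex.Re R).
Local Notation Im := (@complex.Im R).

Lemma ReM (x y : R[i]) :
  Re (x * y) = Re x * Re y - Im x * Im y.
Proof. by case: x y => [a b] [c d]. Qed.

Lemma ImM (x y : R[i]) :
  Im (x * y) = Re x * Im y + Im x * Re y.
Proof. by case: x y => [a b] [c d]. Qed.

Lemma ReD (x y : R[i]) : Re (x + y) = Re x + Re y.
Proof. by case: x y => [a b] [c d]. Qed.

Lemma ImD (x y : R[i]) : Im (x + y) = Im x + Im y.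
Proof. by case: x y => [a b] [c d]. Qed.

Lemma cvg_real_complex (T : Type) (Fi : set_system T) (FF : Filter Fi)
    (f : T -> R) (a : R) :
  f x @[x --> Fi] --> a ->
  (f x)%:C @[x --> Fi] --> (a%:C : (R[i] : numFieldType)).
Proof.
move=> /cvgrPdist_lt fa; apply/(@cvgrPdist_lt C C) => e e0.
have [e1 eE] : exists e1 : R, e = e1%:C.
  exists (Re e); case: e e0 => er ei /=.
  by rewrite ltcE/= => /andP[/eqP -> _].
rewrite eE ltcR in e0 *.
have := fa _ e0; apply: filterS => x.
by rewrite -rmorphB/= normc_def/= expr0n/= addr0 sqrtr_sqr ltcR.
Qed.

Lemma cvg_complex (T : Type) (Fi : set_system T) (FF : Filter Fi)
    (f g : T -> R) (a b : R) :
  f x @[x --> Fi] --> a -> g x @[x --> Fi] --> b ->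
  (f x +i* g x) @[x --> Fi] --> ((a +i* b) : (R[i] : numFieldType)).
Proof.
move=> fa gb; rewrite [a +i* b]complexE/=.
rewrite (_ : (fun x => f x +i* g x) = (fun x => (f x)%:C + 'i * (g x)%:C)).
2: by apply/funext => x; rewrite [LHS]complexE.
apply: (@cvgD C C); first exact: cvg_real_complex.
by apply: (@cvgM C); [exact: cvg_cst|exact: cvg_real_complex].
Qed.

Definition ccontinuous f :=
  continuous (Re \o f) /\ continuous (Im \o f).

Definition cderivative F f := forall x,
  is_derive x (1 : R) (Re \o F) (Re (f x)) /\
  is_derive x (1 : R) (Im \o F) (Im (f x)).

Lemma ccontinuousM f g : ccontinuous f -> ccontinuous g -> ccontinuous (f \* g).
Proof.
move=> [rf jf] [rg jg]; split => x.
  rewrite (_ : _ \o _ = (Re \o f) \* (Re \o g) \-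
    ((Im \o f) \* (Im \o g))); last first.
    by apply/funext => t/=; rewrite ReM.
  by apply: cvgB; apply: cvgM; [exact: rf|exact: rg|exact: jf|exact: jg].
rewrite (_ : _ \o _ = (Re \o f) \* (Im \o g) \+
  ((Im \o f) \* (Re \o g))); last first.
  by apply/funext => t/=; rewrite ImM.
by apply: cvgD; apply: cvgM; [exact: rf|exact: jg|exact: jf|exact: rg].
Qed.

Lemma ccontinuousX f k : ccontinuous f -> ccontinuous (fun x => f x ^+ k).
Proof.
move=> cf; elim: k => [|k IH].
  by split; apply: cst_continuous.
by under eq_fun do rewrite exprS; exact: ccontinuousM.
Qed.

Lemma ccontinuous_real (f : R -> R) : continuous f -> ccontinuous (fun x => (f x)%:C).
Proof. by move=> cf; split => //; exact: cst_continuous. Qed.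

Lemma ccontinuousD f g : ccontinuous f -> ccontinuous g -> ccontinuous (f \+ g).
Proof.
move=> [rf jf] [rg jg]; split => x.
  rewrite (_ : _ \o _ = (Re \o f) \+ (Re \o g)).
    by apply: cvgD; [exact: rf|exact: rg].
  by apply/funext => t/=; rewrite ReD.
rewrite (_ : _ \o _ = (Im \o f) \+ (Im \o g)).
  by apply: cvgD; [exact: jf|exact: jg].
by apply/funext => t/=; rewrite ImD.
Qed.

Lemma ccontinuousZ (c : R[i]) f :
  ccontinuous f -> ccontinuous (fun x => c * f x).
Proof.
move=> cf; apply: (@ccontinuousM (cst c)) => //.
by split; exact: cst_continuous.
Qed.

Lemma cderivative_continuous F f : cderivative F f -> ccontinuous F.
Proof.
move=> dF; split=> x; apply: differentiable_continuous; apply/derivable1_diffP.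
  by have [[]] := dF x.
by have [_ []] := dF x.
Qed.

Lemma cderivativeM F f G g : cderivative F f -> cderivative G g ->
  cderivative (F \* G) (fun x => f x * G x + F x * g x).
Proof.
move=> dF dG x; have [rF jF] := dF x; have [rG jG] := dG x; split.
  rewrite (_ : _ \o _ = (Re \o F) \* (Re \o G) \-
    ((Im \o F) \* (Im \o G))); last first.
    by apply/funext => t/=; rewrite ReM.
  apply: is_derive_eq.
  by rewrite ReD !ReM /GRing.scale/=; ring.
rewrite (_ : _ \o _ = (Re \o F) \* (Im \o G) \+
  ((Im \o F) \* (Re \o G))); last first.
  by apply/funext => t/=; rewrite ImM.
apply: is_derive_eq.
by rewrite ImD !ImM /GRing.scale/=; ring.
Qed.

Lemma cderivative_real (f f' : R -> R) : (forall x : R, is_derive x (1 : R) f (f' x)) ->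
  cderivative (fun x => (f x)%:C) (fun x => (f' x)%:C).
Proof. by move=> df x; split; [exact: df|exact: is_derive_cst]. Qed.

Lemma cderivativeX F f k : cderivative F f ->
  cderivative (fun x => F x ^+ k.+1) (fun x => k.+1%:R * F x ^+ k * f x).
Proof.
move=> dF; elim: k => [|k IH].
  by move=> x; rewrite expr0 mulr1 mul1r; exact: dF.
have := cderivativeM IH dF.
congr cderivative; apply/funext => x.
  by rewrite /= -exprSr.
by rewrite /= -[k.+2%:R]natr1 exprS; ring.
Qed.

End ComplexCalculus.

(** * The integrals of cos^q / (sin - i eps)^k *)

Section CotangentIntegrals.
Context {R : realType}.
Implicit Types (F G f g : R -> R[i]).
Local Notation mu := (@lebesgue_measure R).
Local Notation C := (R[i] : numFieldType).
Local Notation Re := (@complex.Re R).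
Local Notation Im := (@complex.Im R).

(** The integration range is always that of the angle in the substitution
    s = c0 + r sin x, which turns the integrals over slices of a ball into
    integrals of smooth functions, with no singularity at the ends. *)
Definition cint (f : R -> R[i]) : R[i] :=
  (\int[mu]_(x in `[- (pi / 2), pi / 2]) Re (f x)) +i*
  (\int[mu]_(x in `[- (pi / 2), pi / 2]) Im (f x)).

Lemma Npihalf_lt_pihalf : - (pi / 2) < pi / 2 :> R.
Proof. by rewrite gtrN ?divr_gt0 ?pi_gt0. Qed.

Lemma continuous_integrable_itv (f : R -> R) a b : continuous f ->
  mu.-integrable `[a, b] (EFin \o f).
Proof.
move=> cf; apply: continuous_compact_integrable; first exact: segment_compact.
exact: continuous_subspaceT.
Qed.

Lemma cintD f g : ccontinuous f -> ccontinuous g ->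
  cint (fun x => f x + g x) = cint f + cint g.
Proof.
move=> [rf jf] [rg jg]; rewrite /cint.
under eq_Rintegral do rewrite ReD.
rewrite RintegralD//=; [|exact: continuous_integrable_itv..].
under [X in _ +i* X]eq_Rintegral do rewrite ImD.
by rewrite RintegralD//=; exact: continuous_integrable_itv.
Qed.

Lemma cintZ c f : ccontinuous f -> cint (fun x => c * f x) = c * cint f.
Proof.
move=> [rf jf]; rewrite /cint.
have iZ (h : R -> R) (k : R) : continuous h ->
    mu.-integrable `[- (pi / 2), pi / 2] (EFin \o (fun x => k * h x)).
  move=> ch; apply: continuous_integrable_itv => x.
  by apply: cvgM; [exact: cvg_cst|exact: ch].
under eq_Rintegral do rewrite ReM.
rewrite RintegralB//=; [|exact: iZ..].
under [X in _ +i* X]eq_Rintegral do rewrite ImM.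
rewrite RintegralD//=; [|exact: iZ..].
rewrite !RintegralZl//; [|exact: continuous_integrable_itv..].
by case: c => a b.
Qed.

Lemma cint_linear3 a b c f g h :
  ccontinuous f -> ccontinuous g -> ccontinuous h ->
  cint (fun x => a * f x + b * g x + c * h x) =
  a * cint f + b * cint g + c * cint h.
Proof.
move=> cf cg ch; have cZ k q := @ccontinuousZ R k q.
rewrite (@cintD (fun x => a * f x + b * g x) (fun x => c * h x)); last exact: cZ.
  rewrite (@cintD (fun x => a * f x) (fun x => b * g x)); [|exact: cZ..].
  by rewrite !cintZ.
by apply: ccontinuousD; exact: cZ.
Qed.

Lemma cint_derivative F f : cderivative F f -> ccontinuous f ->
  cint f = F (pi / 2) - F (- (pi / 2)).
Proof.
move=> dF [rf jf].
have FTC (H h : R -> R) : (forall x, is_derive x (1 : R) H (h x)) -> continuous h ->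
    \int[mu]_(x in `[- (pi / 2), pi / 2]) h x = H (pi / 2) - H (- (pi / 2)).
  move=> dH ch; rewrite /Rintegral (@continuous_FTC2 _ _ H)//.
  - exact: Npihalf_lt_pihalf.
  - exact: continuous_subspaceT.
  - have cH x : {for x, continuous H}.
      by apply: differentiable_continuous; apply/derivable1_diffP; have [] := dH x.
    split; first by move=> x _; have [] := dH x.
    + exact: cvg_at_right_filter (cH _).
    + exact: cvg_at_left_filter (cH _).
  - by move=> x _; rewrite derive1E; have [] := dH x.
have {}rF : forall x, is_derive x (1 : R) (Re \o F) (Re (f x)) by move=> x; have [] := dF x.
have {}jF : forall x, is_derive x (1 : R) (Im \o F) (Im (f x)) by move=> x; have [] := dF x.
rewrite /cint; have -> := FTC _ _ rF rf; have -> := FTC _ _ jF jf.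
by rewrite /=; case: (F _) => a b; case: (F _).
Qed.

(** The inverse of sin x - i eps; at eps = 0 the power cos^n * cotdenom^n would be
    cot^n. *)
Definition cotdenom (eps x : R) : R[i] := (sin x -i* eps)^-1.

Lemma inv_complex (a b : R) :
  (a -i* b)^-1 = (a / (a ^+ 2 + b ^+ 2)) +i* (b / (a ^+ 2 + b ^+ 2)).
Proof. by rewrite /GRing.inv/= sqrrN mulNr opprK. Qed.

Lemma sum_sqr_gt0 (a b : R) : 0 < b -> 0 < a ^+ 2 + b ^+ 2.
Proof. by move=> b0; rewrite ltr_wpDl ?sqr_ge0 ?exprn_gt0. Qed.

Lemma sub_imaginary_neq0 (a b : R) : 0 < b -> a -i* b != 0.
Proof. by move=> b0; rewrite eq_complex/= oppr_eq0 (gt_eqF b0) andbF. Qed.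

Lemma cderivative_cotdenom eps : 0 < eps ->
  cderivative (cotdenom eps) (fun x => - (cos x)%:C * cotdenom eps x ^+ 2).
Proof.
move=> e0 x.
have h0 : sin x ^+ 2 + eps ^+ 2 != 0 by rewrite gt_eqF ?sum_sqr_gt0.
rewrite /cotdenom; split.
  rewrite (_ : _ \o _ = sin \* (fun t => (sin t ^+ 2 + eps ^+ 2)^-1)); last first.
    by apply/funext => t; rewrite /comp inv_complex.
  apply: is_derive_eq.
  rewrite !inv_complex/= /GRing.scale/=; field.
  exact: h0.
rewrite (_ : _ \o _ = (fun t => eps * (sin t ^+ 2 + eps ^+ 2)^-1)); last first.
  by apply/funext => t; rewrite /comp inv_complex.
apply: is_derive_eq.
rewrite !inv_complex/= /GRing.scale/=; field.
exact: h0.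
Qed.

Lemma ccontinuous_cotdenom eps : 0 < eps -> ccontinuous (cotdenom eps).
Proof. by move=> e0; exact: cderivative_continuous (cderivative_cotdenom e0). Qed.

Definition cotint (k q : nat) (eps : R) : R[i] :=
  cint (fun x => (cos x ^+ q)%:C * cotdenom eps x ^+ k).

Lemma ccontinuous_cotint k q eps : 0 < eps ->
  ccontinuous (fun x => (cos x ^+ q)%:C * cotdenom eps x ^+ k).
Proof.
move=> e0; apply: ccontinuousM; last exact/ccontinuousX/ccontinuous_cotdenom.
apply: ccontinuous_real => x.
exact: (continuous_comp (@continuous_cos R x) (@exprn_continuous R q _)).
Qed.

Lemma sin_cotdenom eps x : 0 < eps ->
  (sin x)%:C * cotdenom eps x = 1 + 'i * eps%:C * cotdenom eps x.
Proof.
move=> e0; rewrite -[1](@mulfV _ (sin x -i* eps)) ?sub_imaginary_neq0//.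
rewrite -mulrDl; congr (_ * _).
by apply/eqP; rewrite eq_complex/=; apply/andP; split; apply/eqP; ring.
Qed.

(** Integration by parts, with primitive cos^(q+1) / (sin - i eps)^(k+1), which
    vanishes at both ends; the factor sin that comes from the derivative of
    cos^(q+1) is sin - i eps plus i eps, hence the two terms on the right. *)
Lemma cotint_parts k q eps : 0 < eps ->
  k.+1%:R * cotint k.+2 q.+2 eps =
  - (q.+1%:R * (cotint k q eps + 'i * eps%:C * cotint k.+1 q eps)).
Proof.
move=> e0.
pose W := cotdenom eps.
have dW : cderivative (fun x => (cos x ^+ q.+1)%:C * W x ^+ k.+1)
   (fun x => - k.+1%:R * ((cos x ^+ q.+2)%:C * W x ^+ k.+2) +
     - q.+1%:R * ((cos x ^+ q)%:C * W x ^+ k) +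
     - (q.+1%:R * ('i * eps%:C)) * ((cos x ^+ q)%:C * W x ^+ k.+1)).
  have dc := cderivativeX q (cderivative_real (@is_derive_cos R)).
  have := cderivativeM dc (cderivativeX k (cderivative_cotdenom e0)).
  congr cderivative; apply/funext => x; first by rewrite /= rmorphXn.
  have E := sin_cotdenom x e0; rewrite -/W in E *.
  transitivity (- (k.+1%:R * ((cos x ^+ q.+2)%:C * W x ^+ k.+2)) -
    q.+1%:R * (cos x ^+ q)%:C * ((sin x)%:C * W x) * W x ^+ k).
    by rewrite rmorphN !rmorphXn/= !exprS; ring.
  by rewrite E !exprS; ring.
have cN a b := ccontinuous_cotint a b e0.
have cf : ccontinuous (fun x => - k.+1%:R * ((cos x ^+ q.+2)%:C * W x ^+ k.+2) +
     - q.+1%:R * ((cos x ^+ q)%:C * W x ^+ k) +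
     - (q.+1%:R * ('i * eps%:C)) * ((cos x ^+ q)%:C * W x ^+ k.+1)).
  by apply: ccontinuousD; [apply: ccontinuousD|]; apply: ccontinuousZ.
move: dW => /cint_derivative => /(_ cf).
rewrite cint_linear3// cosN cos_pihalf !expr0n/= !mul0r subrr -/(cotint _ _ _).
move=> H; apply/eqP; rewrite -subr_eq0 -oppr_eq0 -{}H; apply/eqP.
rewrite /cotint -/W; ring.
Qed.

End CotangentIntegrals.

(** * The limits of these integrals as eps tends to 0 *)

Section CotangentLimits.
Context {R : realType}.
Local Notation mu := (@lebesgue_measure R).
Local Notation C := (R[i] : numFieldType).
Local Notation Re := (@complex.Re R).
Local Notation Im := (@complex.Im R).

(** Dominated convergence along an arbitrary sequence that decreases to 0; the
    exceptional point 0 is the zero of sin. *)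
Lemma cvg_Rintegral_bounded (f : R -> R -> R) a b :
  (forall e, 0 < e -> continuous (f e)) ->
  (forall e x, 0 < e -> `|f e x| <= 1) ->
  (forall x, x \in `[a, b] -> x != 0 -> f e x @[e --> 0^'+] --> 0) ->
  \int[mu]_(x in `[a, b]) f e x @[e --> 0^'+] --> 0.
Proof.
move=> cf f1 f0; apply/cvg_at_rightP => u [u0 u_0].
have mf n : measurable_fun `[a, b] (fun x => (f (u n) x)%:E).
  apply/measurable_EFinP/measurable_funTS.
  by apply: continuous_measurable_fun; exact: cf.
have [| | |_ _] := @dominated_convergence _ _ R mu `[a, b] (measurable_itv _)
  (fun n x => (f (u n) x)%:E) (cst 0%E) (cst 1%E) mf (measurable_cst _).
- exists [set 0]; split; [exact: measurable_set1|exact: lebesgue_measure_set1|].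
  move=> x /= /not_implyP[xab]; apply: contra_notP => /eqP x0.
  apply: cvg_EFin; first exact: nearW.
  by move/cvg_at_rightP : (f0 x xab x0); apply.
- apply: continuous_compact_integrable; first exact: segment_compact.
  by apply: continuous_subspaceT; exact: cst_continuous.
- by apply: aeW => x n _; rewrite lee_fin f1.
by rewrite integral0 => H; apply: fine_cvg; exact: H.
Qed.

Definition csqnorm (z : R[i]) : R := Re z ^+ 2 + Im z ^+ 2.

Lemma csqnormM y z : csqnorm (y * z) = csqnorm y * csqnorm z.
Proof. by rewrite /csqnorm ReM ImM; ring. Qed.

Lemma csqnormX z k : csqnorm (z ^+ k) = csqnorm z ^+ k.
Proof.
elim: k => [|k IH]; first by rewrite /csqnorm/= expr1n expr0n/= addr0.
by rewrite !exprS csqnormM IH.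
Qed.

Lemma csqnorm_cotdenom eps x : 0 < eps ->
  csqnorm (eps%:C * cotdenom eps x) = eps ^+ 2 / (sin x ^+ 2 + eps ^+ 2).
Proof.
move=> e0; have := sum_sqr_gt0 (sin x) e0 => /gt_eqF/negbT h.
by rewrite csqnormM /csqnorm /cotdenom inv_complex/=; field.
Qed.

Lemma csqnorm_cotdenomX_le1 eps x d : 0 < eps ->
  csqnorm ((eps%:C * cotdenom eps x) ^+ d) <= 1.
Proof.
move=> e0; rewrite csqnormX csqnorm_cotdenom//; apply: exprn_ile1.
  by rewrite divr_ge0 ?addr_ge0 ?sqr_ge0.
by rewrite ler_pdivrMr ?sum_sqr_gt0// mul1r lerDr sqr_ge0.
Qed.

(** One of the d+1 factors gives the decay, the others have modulus at most 1. *)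
Lemma csqnorm_cotdenomX_le eps x d : 0 < eps -> sin x != 0 ->
  csqnorm ((eps%:C * cotdenom eps x) ^+ d.+1) <= (eps / sin x) ^+ 2.
Proof.
move=> e0 s0; rewrite exprS csqnormM -[leRHS]mulr1; apply: ler_pM.
- by rewrite addr_ge0 ?sqr_ge0.
- by rewrite addr_ge0 ?sqr_ge0.
- rewrite csqnorm_cotdenom// expr_div_n ler_wpM2l ?sqr_ge0//.
  by rewrite lef_pV2 ?posrE ?sum_sqr_gt0 ?exprn_even_gt0// lerDl sqr_ge0.
- exact: csqnorm_cotdenomX_le1.
Qed.

Lemma sin_neq0_pihalf (x : R) : x \in `[- (pi / 2), pi / 2] -> x != 0 -> sin x != 0.
Proof.
move=> xI; apply: contra_neq => sx0; apply: sin_inj; rewrite ?sin0//.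
by rewrite in_itv/= oppr_le0 divr_ge0 ?pi_ge0.
Qed.

Lemma cvg_complex0 (f : R -> R[i]) :
  Re (f x) @[x --> 0^'+] --> 0 -> Im (f x) @[x --> 0^'+] --> 0 ->
  f x @[x --> 0^'+] --> (0 : C).
Proof.
move=> rf jf; rewrite (_ : f = fun x => Re (f x) +i* Im (f x)).
  exact: (cvg_complex _ rf jf).
by apply/funext => x; case: (f x).
Qed.

Lemma cvg_at_right_eq (f g : R -> R[i]) (l : C) :
  (\forall x \near 0^'+, f x = g x) ->
  f x @[x --> 0^'+] --> l -> g x @[x --> 0^'+] --> l.
Proof. by move=> fg; apply: cvg_trans; exact: near_eq_cvg. Qed.

(** The integrand (eps / (sin - i eps))^(d+1) is bounded by 1 and tends to 0 away
    from the zero of sin. *)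
Lemma cotint0_limit d :
  eps%:C ^+ d.+1 * cotint d.+1 0 eps @[eps --> 0^'+] --> (0 : C).
Proof.
have cz e : 0 < e -> ccontinuous (fun x => (e%:C * cotdenom e x) ^+ d.+1).
  by move=> e0; apply/ccontinuousX/ccontinuousZ/ccontinuous_cotdenom.
have E : \forall e \near 0^'+, cint (fun x : R => (e%:C * cotdenom e x) ^+ d.+1) =
    e%:C ^+ d.+1 * cotint d.+1 0 e.
  near=> e; have e0 : 0 < e by [].
  rewrite -cintZ; last exact: ccontinuous_cotint.
  by congr cint; apply/funext => x; rewrite expr0 mul1r exprMn.
apply: (cvg_at_right_eq E).
have pointwise (p : R[i] -> R) : (forall z, p z ^+ 2 <= csqnorm z) ->
    forall x, x \in `[- (pi / 2), pi / 2] -> x != 0 ->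
    p ((e%:C * cotdenom e x) ^+ d.+1) @[e --> 0^'+] --> 0.
  move=> pn x xI x0; have s0 := sin_neq0_pihalf xI x0.
  have cvge : e / `|sin x| @[e --> 0^'+] --> 0.
    rewrite -[X in _ --> X](mul0r `|sin x|^-1); apply: cvgM; last exact: cvg_cst.
    exact: cvg_at_right_filter cvg_id.
  apply: norm_cvg0; apply: (@squeeze_cvgr _ _ _ _ (cst 0) (fun e => e / `|sin x|)).
  - near=> e; have e0 : 0 < e by [].
    rewrite normr_ge0/= -ler_sqr ?nnegrE ?divr_ge0 ?(ltW e0)//.
    have nK (y : R) : `|y| ^+ 2 = y ^+ 2 by rewrite real_normK ?num_real.
    rewrite nK (_ : (e / `|sin x|) ^+ 2 = (e / sin x) ^+ 2); last first.
      by rewrite !expr_div_n nK.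
    exact: le_trans (pn _) (csqnorm_cotdenomX_le _ _ _).
  - exact: cvg_cst.
  - exact: cvge.
have bnd (p : R[i] -> R) : (forall z, p z ^+ 2 <= csqnorm z) ->
    forall e x, 0 < e -> `|p ((e%:C * cotdenom e x) ^+ d.+1)| <= 1.
  move=> pn e x e0; rewrite -ler_sqr ?nnegrE// expr1n real_normK ?num_real//.
  exact: le_trans (pn _) (csqnorm_cotdenomX_le1 _ _ _).
have Ren z : Re z ^+ 2 <= csqnorm z by rewrite lerDl sqr_ge0.
have Imn z : Im z ^+ 2 <= csqnorm z by rewrite lerDr sqr_ge0.
apply: cvg_complex0; apply: cvg_Rintegral_bounded.
- by move=> e /cz[].
- exact: bnd.
- exact: pointwise.
- by move=> e /cz[].
- exact: bnd.
- exact: pointwise.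
Unshelve. all: by end_near. Qed.

Lemma cotint00 eps : cotint 0 0 eps = pi%:C :> R[i].
Proof.
rewrite /cotint (_ : (fun x : R => _) = cst 1); last first.
  by apply/funext => x; rewrite !expr0 mul1r.
rewrite /cint /= !Rintegral_cst//= mul0r mul1r lebesgue_measure_itv/= lte_fin.
by rewrite Npihalf_lt_pihalf/= opprK -splitr.
Qed.

(** With a single factor cos the integrand is an exact derivative. *)
Lemma cotint1_primitive d (eps : R) : 0 < eps ->
  d.+1%:R * cotint d.+2 1 eps =
  cotdenom eps (- (pi / 2)) ^+ d.+1 - cotdenom eps (pi / 2) ^+ d.+1.
Proof.
move=> e0; have cN := ccontinuous_cotint d.+2 1 e0.
rewrite /cotint; apply: oppr_inj; rewrite -mulNr -cintZ// opprB.
rewrite (@cint_derivative _ (fun x => cotdenom eps x ^+ d.+1))//.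
  have := cderivativeX d (cderivative_cotdenom e0).
  congr cderivative; apply/funext => x.
  by rewrite expr1 [in RHS]exprS [in RHS]exprS; ring.
exact: ccontinuousZ.
Qed.

Lemma cvg_eps_complex : eps%:C @[eps --> (0 : R)^'+] --> (0 : C).
Proof. by apply: cvg_real_complex; exact: cvg_at_right_filter cvg_id. Qed.

Lemma cvg_eps_cotdenom (x : R) : sin x != 0 ->
  eps%:C * cotdenom eps x @[eps --> 0^'+] --> (0 : C).
Proof.
move=> s0; rewrite -[X in _ --> X](mul0r ((sin x)%:C)^-1).
apply: (@cvgM C); first exact: cvg_eps_complex.
apply: (@cvgV C); first by rewrite fmorph_eq0.
rewrite (_ : (sin x)%:C = sin x -i* 0); last by rewrite oppr0.
apply: cvg_complex; first exact: cvg_cst.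
by apply: cvgN; exact: cvg_at_right_filter cvg_id.
Qed.

Lemma cvg_complexX0 (f : R -> R[i]) d : f x @[x --> 0^'+] --> (0 : C) ->
  f x ^+ d.+1 @[x --> 0^'+] --> (0 : C).
Proof.
move=> f0; elim: d => [//|d IH].
rewrite -[X in _ --> X](mulr0 (0 : C)); under eq_fun do rewrite exprS.
exact: (@cvgM C).
Qed.

Lemma cotint1_limit d :
  eps%:C ^+ d.+1 * cotint d.+2 1 eps @[eps --> 0^'+] --> (0 : C).
Proof.
have s1 : sin (pi / 2) != 0 :> R by rewrite sin_pihalf oner_neq0.
have s2 : sin (- (pi / 2)) != 0 :> R by rewrite sinN oppr_eq0.
have E : \forall e \near (0 : R)^'+,
    (d.+1%:R)^-1 * ((e%:C * cotdenom e (- (pi / 2))) ^+ d.+1 -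
                    (e%:C * cotdenom e (pi / 2)) ^+ d.+1) =
    e%:C ^+ d.+1 * cotint d.+2 1 e.
  near=> e; have e0 : 0 < e by [].
  rewrite !exprMn -mulrBr -cotint1_primitive//.
  by rewrite mulrCA mulKf ?pnatr_eq0.
apply: (cvg_at_right_eq E).
rewrite -[X in _ --> X](mulr0 (d.+1%:R^-1 : C)); apply: (@cvgM C).
  exact: cvg_cst.
rewrite -[X in _ --> X](subr0 (0 : C)).
by apply: (@cvgB C C); apply: cvg_complexX0; exact: cvg_eps_cotdenom.
Unshelve. all: by end_near. Qed.

(** The primitive is the logarithm of sin - i eps up to a constant, written with ln
    and atan to avoid a complex logarithm; its real part is even, so only the
    variation of the argument remains. *)
Lemma cotint11 (eps : R) : 0 < eps ->
  cotint 1 1 eps = 0 +i* (atan eps^-1 *+ 2).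
Proof.
move=> e0; rewrite /cotint.
have h x : 0 < sin x ^+ 2 + eps ^+ 2 by exact: sum_sqr_gt0.
have h0 x : sin x ^+ 2 + eps ^+ 2 != 0 by rewrite gt_eqF.
rewrite (@cint_derivative _
  (fun x => (ln (sin x ^+ 2 + eps ^+ 2) / 2) +i* atan (eps^-1 * sin x))).
- rewrite sinN sqrrN sin_pihalf mulrN !mulr1 atanN.
  by congr (_ +i* _); rewrite ?subrr//= opprK mulr2n.
- move=> x; rewrite expr1 /cotdenom; split.
    rewrite (_ : _ \o _ = (@ln R \o (fun t => sin t ^+ 2 + eps ^+ 2)) * cst 2^-1)//.
    have ? := is_derive1_ln (h x).
    apply: is_derive_eq.
    rewrite inv_complex/= /GRing.scale/=; field.
    exact: h0.
  rewrite (_ : _ \o _ = @atan R \o (fun t => eps^-1 * sin t))//.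
  apply: is_derive_eq.
  have e00 := gt_eqF e0.
  rewrite inv_complex/= /GRing.scale/=; field.
  by rewrite h0 e00.
- exact: ccontinuous_cotint.
Qed.

Lemma cotint11_limit :
  cotint 1 1 eps @[eps --> 0^'+] --> ('i * pi%:C : C).
Proof.
have E : \forall e \near (0 : R)^'+, 0 +i* (atan e^-1 *+ 2) = cotint 1 1 e :> R[i].
  by near=> e; rewrite cotint11.
apply: (cvg_at_right_eq E).
rewrite (_ : 'i * pi%:C = 0 +i* pi); last first.
  by apply/eqP; rewrite eq_complex/=; apply/andP; split; apply/eqP; ring.
apply: cvg_complex; first exact: cvg_cst.
rewrite [X in _ --> X](_ : pi = (pi / 2) *+ 2); last by rewrite mulr2n -splitr.
apply: cvgMn; apply: cvg_comp; last exact: cvgy_atan.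
by apply/cvgrVy; [near=> e|apply: (@cvg_at_right_filter _ _ (@id R)); exact: cvg_id].
Unshelve. all: by end_near. Qed.

(** The case d = 0 is the value i^q pi of the regularized integral of cot^q.  The
    recurrence cotint_parts expresses it by the case q - 2 and by a term with one
    more power of sin - i eps in the denominator and one more factor eps.  The
    integrals with d > 0 diverge, but no faster than eps^-d, and the statement
    that the factor eps^d makes them tend to 0 is stable under the same
    recurrence; this is why all d are treated at once. *)
Theorem cotint_limit q d :
  eps%:C ^+ d * cotint (q + d) q eps @[eps --> 0^'+] -->
  (if d == 0%N then 'i ^+ q * pi%:C else 0 : C).
Proof.
elim/ltn_ind: q d => -[|[|q]] IH d.
- rewrite add0n; case: d => [|d]; last exact: cotint0_limit.
  rewrite eqxx expr0 mul1r.
  by under eq_fun do rewrite expr0 mul1r cotint00; exact: (@cvg_cst C).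
- rewrite add1n; case: d => [|d]; last exact: cotint1_limit.
  by rewrite eqxx expr1; under eq_fun do rewrite expr0 mul1r; exact: cotint11_limit.
have E : \forall e \near (0 : R)^'+,
    - (q.+1%:R / (q + d).+1%:R) * (e%:C ^+ d * cotint (q + d) q e +
      'i * (e%:C ^+ d.+1 * cotint (q + d.+1) q e)) =
    e%:C ^+ d * cotint (q.+2 + d) q.+2 e.
  near=> e; have e0 : 0 < e by [].
  have k0 : (q + d).+1%:R != 0 :> R[i] by rewrite pnatr_eq0.
  apply: (mulfI k0); rewrite [RHS]mulrCA cotint_parts// addnS exprSr.
  by field.
apply: (cvg_at_right_eq E).
have q2 : (q < q.+2)%N by [].
rewrite (_ : (if d == 0%N then _ else _) =
  - (q.+1%:R / (q + d).+1%:R) *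
  ((if d == 0%N then 'i ^+ q * pi%:C else 0) + 'i * 0) :> C); last first.
  case: d {E} => [|d]/=; last by rewrite !mulr0 addr0 mulr0.
  by rewrite addn0 divff ?pnatr_eq0// mulr0 addr0 !exprS mulrA -expr2 sqr_i !mulN1r mulNr.
apply: (@cvgM C); first exact: (@cvg_cst C).
apply: (@cvgD C C); first exact: IH.
by apply: (@cvgM C); [exact: (@cvg_cst C)|exact: (IH q q2 d.+1)].
Unshelve. all: by end_near. Qed.

End CotangentLimits.

(** * Integrals over sets that are measurable up to a null set *)

Section Sandwich.
Context d (T : measurableType d) (R : realType) (mu : {measure set T -> \bar R}).
Local Open Scope ereal_scope.

(** The integral of a nonnegative function is a supremum over the simple functions
    below it, hence monotone in the domain even among nonmeasurable sets. *)
Lemma ge0_integral_subset (D D' : set T) (f : T -> \bar R) :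
  (forall x, 0 <= f x) -> D `<=` D' ->
  \int[mu]_(x in D) f x <= \int[mu]_(x in D') f x.
Proof.
move=> f0 DD'; rewrite !ge0_integralE//; apply: le_ereal_sup => _ [h hf <-].
exists h => // x; apply: (le_trans (hf x)); rewrite !patchE.
by case: ifPn => [/set_mem/DD'/mem_set ->//|_]; case: ifPn.
Qed.

(** D may be nonmeasurable: this is for regions that are known only outside the
    hyperplane x_0 = 0, whose points correspond to the points at infinity. *)
Lemma integral_sandwich (B D Z : set T) (f : T -> \bar R) :
  measurable B -> measurable Z -> mu Z = 0 -> measurable_fun setT f ->
  (forall x, ~ Z x -> (D x <-> B x)) ->
  \int[mu]_(x in D) f x = \int[mu]_(x in B) f x.
Proof.
move=> mB mZ Z0.
have ge0 (g : T -> \bar R) : measurable_fun setT g -> (forall x, 0 <= g x) ->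
    (forall x, ~ Z x -> (D x <-> B x)) ->
    \int[mu]_(x in D) g x = \int[mu]_(x in B) g x.
  move=> mg g0 DB; apply/eqP; rewrite eq_le; apply/andP; split.
    apply: (@le_trans _ _ (\int[mu]_(x in B `|` Z) g x)).
      apply: ge0_integral_subset => // x Dx.
      by have [Zx|/DB h] := pselect (Z x); [right|left; apply/h].
    rewrite (@ge0_negligible_integral _ _ _ _ _ Z)//; last 2 first.
    - exact: measurableU.
    - exact: measurable_funTS.
    by rewrite setDUl setDv setU0; apply: ge0_integral_subset => // x [].
  rewrite (@ge0_negligible_integral _ _ _ _ _ Z)//; last exact: measurable_funTS.
  by apply: ge0_integral_subset => // x [Bx /DB]; tauto.
move=> mf DB; rewrite integralE [RHS]integralE; congr (_ - _); apply: ge0 => //.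
- exact: measurable_funepos.
- exact: measurable_funeneg.
Qed.

End Sandwich.

(** * Balls and their slices *)

Section LebesgueTuple.
Context {R : realType}.
Local Notation mu := (@lebesgue_measure R).
Local Notation T m := (m.-tuple (measurableTypeR R)).

Lemma measurable_tuple_cons m :
  measurable_fun setT (@tuple_cons R m : measurableTypeR R * T m -> T m.+1).
Proof. exact: measurable_cons. Qed.

(** Tonelli's theorem for the iterated product that defines lebesgue_tuple, with
    the first coordinate integrated last. *)
Lemma integral_lebesgue_tupleS m (f : T m.+1 -> \bar R) :
  measurable_fun setT f -> (forall t, (0 <= f t)%E) ->
  (\int[lebesgue_tuple R m.+1]_t f t =
   \int[mu]_s \int[lebesgue_tuple R m]_y f (tuple_cons (s, y)))%E.
Proof.
move=> mf f0; rewrite /= /lebesgue_step.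
rewrite ge0_integral_pushforward//; last exact: measurable_tuple_cons.
rewrite preimage_setT fubini_tonelli1//; last by move=> x; exact: f0.
by apply: measurableT_comp => //; exact: measurable_tuple_cons.
Qed.

(** The other order of integration: the first coordinate is integrated first. *)
Lemma integral_lebesgue_tupleS_swap m (f : T m.+1 -> \bar R) :
  measurable_fun setT f -> (forall t, (0 <= f t)%E) ->
  (\int[lebesgue_tuple R m.+1]_t f t =
   \int[lebesgue_tuple R m]_y \int[mu]_s f (tuple_cons (s, y)))%E.
Proof.
move=> mf f0; rewrite /= /lebesgue_step.
rewrite ge0_integral_pushforward//; last exact: measurable_tuple_cons.
rewrite preimage_setT fubini_tonelli2//; last by move=> x; exact: f0.
by apply: measurableT_comp => //; exact: measurable_tuple_cons.
Qed.

Definition tball m (closed : bool) (c : T m) (r2 : R) : set (T m) :=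
  [set t : T m | \sum_(j < m) (tnth t j - tnth c j) ^+ 2 < r2 ?<= if closed].

Lemma measurable_tdist m (c : T m) : measurable_fun setT
  (fun t : T m => \sum_(j < m) (tnth t j - tnth c j) ^+ 2).
Proof.
apply: measurable_sum => j; apply: measurable_funX; apply: measurable_funB => //.
exact: measurable_tnth.
Qed.

Lemma measurable_tball m b (c : T m) r2 : measurable (tball b c r2).
Proof.
have := @measurable_tdist m c measurableT.
case: b => h.
  have := h _ (measurable_itv `]-oo, r2]); rewrite setTI.
  by congr measurable; apply/seteqP; split => t /=; rewrite in_itv.
have := h _ (measurable_itv `]-oo, r2[); rewrite setTI.
by congr measurable; apply/seteqP; split => t /=; rewrite in_itv.
Qed.

Lemma tball_cons m b (c0 : R) (c : T m) r2 s (y : T m) :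
  tball b (tuple_cons (c0, c) : T m.+1) r2 (tuple_cons (s, y)) =
  tball b c (r2 - (s - c0) ^+ 2) y.
Proof.
rewrite /tball /= big_ord_recl/= !tnth0 lteifBrDl.
by under eq_bigr do rewrite !tnthS.
Qed.

(** The recurrence is the slicing of the unit ball by its first coordinate sin x;
    that this is the volume of the unit ball is ball_volume_correct. *)
Fixpoint ball_volume (m : nat) : R :=
  if m is k.+1 then
    ball_volume k * \int[mu]_(x in `[- (pi / 2), pi / 2]) cos x ^+ k.+1
  else 1.

Definition ball_volume_spec m := forall b (c : T m) r, 0 < r ->
  lebesgue_tuple R m (tball b c (r ^+ 2)) = (ball_volume m * r ^+ m)%:E.

(** The volume of the slice at s of the (m+1)-dimensional ball of radius r whose
    centre has first coordinate c0; it is 0 or the constant ball_volume 0 outside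
    of the ball. *)
Definition slice_volume m (c0 r s : R) : R :=
  ball_volume m * Num.sqrt (r ^+ 2 - (s - c0) ^+ 2) ^+ m.

Lemma continuous_slice_volume m c0 r : continuous (slice_volume m c0 r).
Proof.
move=> s; apply: cvgM; first exact: cvg_cst.
apply: (@cvg_comp _ _ _ (fun s => Num.sqrt (r ^+ 2 - (s - c0) ^+ 2)) (fun x => x ^+ m));
  last exact: exprn_continuous.
apply: (@cvg_comp _ _ _ (fun s => (r ^+ 2 - (s - c0) ^+ 2)) Num.sqrt);
  last exact: sqrt_continuous.
apply: cvgB; first exact: cvg_cst.
apply: (@cvg_comp _ _ _ (fun s => s - c0) (fun x => x ^+ 2));
  last exact: exprn_continuous.
by apply: cvgB; [exact: cvg_id|exact: cvg_cst].
Qed.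

(** Slicing of a ball at a fixed value of the first coordinate.  The slices are
    balls of the same kind, open or closed, except at the two ends, which are
    null. *)
Lemma ge0_integral_tball m b (c0 : R) (c : T m) r (f : R -> R) :
  ball_volume_spec m -> 0 < r -> measurable_fun setT f -> (forall s, 0 <= f s) ->
  (\int[lebesgue_tuple R m.+1]_(t in tball b (tuple_cons (c0, c)) (r ^+ 2))
     (f (thead t))%:E =
   \int[mu]_(s in `[(c0 - r)%R, (c0 + r)%R]) (f s * slice_volume m c0 r s)%R%:E)%E.
Proof.
move=> Hm r0 mf f0.
set B := tball _ _ _.
have mB : measurable B by exact: measurable_tball.
have mfh : measurable_fun setT (fun t : T m.+1 => (f (thead t))%:E).
  apply/measurable_EFinP; apply: measurableT_comp => //; exact: measurable_tnth.
rewrite integral_mkcond integral_lebesgue_tupleS; last 2 first.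
- apply/(measurable_restrict _ _ _) => //; exact: measurable_funTS.
- by move=> t; rewrite patchE; case: ifPn => // _; rewrite lee_fin.
have inner s : (\int[lebesgue_tuple R m]_y
      ((fun t : T m.+1 => (f (thead t))%:E) \_ B) (tuple_cons (s, y)) =
    (f s)%:E * lebesgue_tuple R m (tball b c (r ^+ 2 - (s - c0) ^+ 2)%R))%E.
  rewrite -integral_cst; last exact: measurable_tball.
  rewrite [RHS]integral_mkcond; apply: eq_integral => y _.
  rewrite !patchE; congr (if _ then _ else _).
  by rewrite /B; apply/idP/idP; rewrite !inE tball_cons.
under eq_integral do rewrite inner.
transitivity (\int[mu]_(s in `[(c0 - r)%R, (c0 + r)%R])
    ((f s)%:E * lebesgue_tuple R m (tball b c (r ^+ 2 - (s - c0) ^+ 2)%R)))%E.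
  rewrite [RHS]integral_mkcond; apply: eq_integral => s _; rewrite patchE.
  case: ifPn => // /negP sI; rewrite (_ : tball _ _ _ = set0) ?measure0 ?mule0//.
  rewrite -subset0 => y; rewrite /tball/= => hy.
  apply: sI; apply/mem_set; rewrite /= in_itv/= -ler_distlC.
  rewrite -ler_sqr ?nnegrE ?(ltW r0)// real_normK ?num_real//.
  rewrite -sqrrN opprB -subr_ge0; apply: le_trans (lteifW hy).
  by apply: sumr_ge0 => j _; exact: sqr_ge0.
have inside s : s \in `]c0 - r, c0 + r[ ->
    ((f s)%:E * lebesgue_tuple R m (tball b c (r ^+ 2 - (s - c0) ^+ 2)%R))%E =
    (f s * slice_volume m c0 r s)%R%:E.
  rewrite in_itv/= -ltr_distlC => sI.
  have h : 0 < r ^+ 2 - (s - c0) ^+ 2.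
    rewrite subr_gt0 -[ltLHS]real_normK ?num_real// distrC.
    by rewrite ltr_sqr ?nnegrE ?normr_ge0 ?(ltW r0).
  by rewrite -{1}(sqr_sqrtr (ltW h)) Hm ?sqrtr_gt0// EFinM.
have mfs : measurable_fun setT (fun s => (f s * slice_volume m c0 r s)%R%:E).
  apply/measurable_EFinP; apply: measurable_funM => //.
  by apply: continuous_measurable_fun; exact: continuous_slice_volume.
rewrite (integral_itv_bndoo true false); last first.
  apply: (eq_measurable_fun (fun s => (f s * slice_volume m c0 r s)%R%:E)).
    by move=> s /set_mem sI; rewrite inside.
  exact: measurable_funTS.
rewrite (integral_itv_bndoo true false); last exact: measurable_funTS.
by apply: eq_integral => s /set_mem sI; rewrite inside.
Qed.

Lemma ball_volume_ge0 m : 0 <= ball_volume m.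
Proof.
elim: m => [|m IH] //=; apply: mulr_ge0 => //; apply: Rintegral_ge0 => x /=.
rewrite in_itv/= => xI; apply: exprn_ge0; exact: cos_ge0_pihalf.
Qed.

Lemma slice_volume_ge0 m c0 r s : 0 <= slice_volume m c0 r s.
Proof. by rewrite mulr_ge0 ?ball_volume_ge0// exprn_ge0// sqrtr_ge0. Qed.

(** The positive and negative parts are sliced separately; multiplying by the
    nonnegative slice_volume commutes with taking these parts. *)
Lemma integral_tball m b (c0 : R) (c : T m) r (f : R -> R) :
  ball_volume_spec m -> 0 < r -> measurable_fun setT f ->
  (\int[lebesgue_tuple R m.+1]_(t in tball b (tuple_cons (c0, c)) (r ^+ 2))
     (f (thead t))%:E =
   \int[mu]_(s in `[(c0 - r)%R, (c0 + r)%R]) (f s * slice_volume m c0 r s)%R%:E)%E.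
Proof.
move=> Hm r0 mf; rewrite integralE [RHS]integralE.
have key (h : R -> R) (k : T m.+1 -> \bar R) (l : R -> \bar R) :
    measurable_fun setT h -> (forall s, 0 <= h s) ->
    (forall t, k t = (h (thead t))%:E) ->
    (forall s, l s = (h s * slice_volume m c0 r s)%:E) ->
    (\int[lebesgue_tuple R m.+1]_(t in tball b (tuple_cons (c0, c)) (r ^+ 2)) k t
     = \int[mu]_(s in `[(c0 - r)%R, (c0 + r)%R]) l s)%E.
  move=> mh h0 kE lE.
  rewrite (eq_integral (fun t : T m.+1 => (h (thead t))%:E)); last by move=> t _.
  rewrite ge0_integral_tball//; apply: eq_integral => s _; exact/esym.
congr (_ - _)%E.
- apply: (key (f ^\+)%R) => //; first exact: measurable_funrpos.
  by move=> t; rewrite funeposE (_ : (f ^\+)%R _ = Num.max (f (thead t)) 0)// EFin_max.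
  move=> s; rewrite funeposE (_ : (f ^\+)%R s = Num.max (f s) 0)//.
  by rewrite -EFin_max maxr_pMl ?slice_volume_ge0// mul0r.
- apply: (key (f ^\-)%R) => //; first exact: measurable_funrneg.
  by move=> t; rewrite funenegE (_ : (f ^\-)%R _ = Num.max (- f (thead t)) 0)// EFin_max.
  move=> s; rewrite funenegE (_ : (f ^\-)%R s = Num.max (- f s) 0)//.
  by rewrite -EFinN -EFin_max maxr_pMl ?slice_volume_ge0// mul0r mulNr.
Qed.

(** The substitution s = c0 + r sin x. *)
Lemma integral_slice_volume m c0 r (f : R -> R) : 0 < r -> continuous f ->
  (\int[mu]_(s in `[(c0 - r)%R, (c0 + r)%R]) (f s * slice_volume m c0 r s)%R%:E =
   \int[mu]_(x in `[(- (pi / 2))%R, (pi / 2)%R])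
     (ball_volume m * (f (c0 + r * sin x) * (r * cos x) ^+ m.+1))%R%:E)%E.
Proof.
move=> r0 cf.
pose F (x : R) := c0 + r * sin x.
have dF (x : R) : is_derive x (1 : R) F (r * cos x).
  apply: is_derive_eq; rewrite /GRing.scale/=; ring.
have F'E : (derive1 F) = fun x => r * cos x.
  by apply/funext => x; rewrite derive1E; have [] := dF x.
have cF x : {for x, continuous F}.
  by apply: differentiable_continuous; apply/derivable1_diffP; have [] := dF x.
have cF' x : {for x, continuous (derive1 F)}.
  by rewrite F'E; apply: cvgM; [exact: cvg_cst|exact: continuous_cos].
have Fr : c0 + r = F (pi / 2) by rewrite /F sin_pihalf mulr1.
have Fl : c0 - r = F (- (pi / 2)) by rewrite /F sinN sin_pihalf mulrN mulr1.
rewrite Fr Fl.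
rewrite (@integration_by_substitution_increasing _ F (fun s => f s * slice_volume m c0 r s)).
- apply: eq_integral => x; rewrite inE/= in_itv/= => xI; congr EFin.
  rewrite F'E [LHS](_ : _ = f (F x) * slice_volume m c0 r (F x) * (r * cos x))//.
  rewrite /slice_volume.
  have -> : Num.sqrt (r ^+ 2 - (F x - c0) ^+ 2) = r * cos x.
    have -> : r ^+ 2 - (F x - c0) ^+ 2 = (r * cos x) ^+ 2.
      by rewrite exprMn cos2sin2 /F; ring.
    by rewrite sqrtr_sqr ger0_norm// mulr_ge0 ?(ltW r0)// cos_ge0_pihalf.
  by rewrite /F exprS; ring.
- exact/ltW/Npihalf_lt_pihalf.
- move=> x y xI yI xy; rewrite /F ltrD2l ltr_pM2l//.
  by rewrite ltr_sin.
- by move=> x _; exact: cF'.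
- by apply/cvg_ex; eexists; exact: cvg_at_right_filter (cF' _).
- by apply/cvg_ex; eexists; exact: cvg_at_left_filter (cF' _).
- split; first by move=> x _; have [] := dF x.
  + exact: cvg_at_right_filter (cF _).
  + exact: cvg_at_left_filter (cF _).
- apply: continuous_subspaceT => s; apply: cvgM; first exact: cf.
  exact: continuous_slice_volume.
Qed.

Lemma Rintegral_fine_itv (f : R -> R) a b : continuous f ->
  (\int[mu]_(x in `[a, b]) (f x)%:E = (\int[mu]_(x in `[a, b]) f x)%R%:E)%E.
Proof.
move=> cf; rewrite /Rintegral fineK//; apply: integrable_fin_num => //.
exact: continuous_integrable_itv.
Qed.

Lemma continuous_cosX k : continuous (fun x : R => cos x ^+ k).
Proof.
move=> x.
exact: (continuous_comp (@continuous_cos R x) (@exprn_continuous R k _)).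
Qed.

(** Induction on the dimension: slicing the constant function 1 in dimension m+1
    uses only the volumes of the m-dimensional balls. *)
Lemma ball_volume_correct m : ball_volume_spec m.
Proof.
elim: m => [|m IH] b c r r0.
  rewrite /= expr0 mulr1 diracE mem_set//= /tball/= big_ord0.
  by case: b => /=; rewrite ?exprn_gt0// ltW// exprn_gt0.
rewrite (tuple_eta c) -[LHS]mul1e -integral_cst; last exact: measurable_tball.
have := @integral_tball m b (thead c) [tuple of behead c] r (cst 1) IH r0 (measurable_cst _).
move=> /= ->; rewrite integral_slice_volume//; last exact: cst_continuous.
transitivity (\int[mu]_(x in `[(- (pi / 2))%R, (pi / 2)%R])
    (ball_volume m * r ^+ m.+1 * cos x ^+ m.+1)%R%:E)%E.
  by apply: eq_integral => x _; congr EFin; rewrite mul1r exprMn mulrA.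
rewrite Rintegral_fine_itv; last first.
  by move=> x; apply: cvgM; [exact: cvg_cst|exact: continuous_cosX].
rewrite RintegralZl//; last exact/continuous_integrable_itv/continuous_cosX.
by rewrite mulrAC.
Qed.

Lemma Rintegral_tball m b (c0 : R) (c : T m) r (f : R -> R) :
  0 < r -> continuous f ->
  \int[lebesgue_tuple R m.+1]_(t in tball b (tuple_cons (c0, c)) (r ^+ 2))
     f (thead t) =
  ball_volume m *
  \int[mu]_(x in `[- (pi / 2), pi / 2]) (f (c0 + r * sin x) * (r * cos x) ^+ m.+1).
Proof.
move=> r0 cf; rewrite [LHS]/Rintegral integral_tball//; last 2 first.
- exact: ball_volume_correct.
- exact: continuous_measurable_fun.
have cfF : continuous (fun x : R => f (c0 + r * sin x) * (r * cos x) ^+ m.+1).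
  move=> x; apply: cvgM.
    apply: (@cvg_comp _ _ _ (fun x => c0 + r * sin x) f); last exact: cf.
    apply: cvgD; first exact: cvg_cst.
    by apply: cvgM; [exact: cvg_cst|exact: continuous_sin].
  apply: (@cvg_comp _ _ _ (fun x => r * cos x) (fun y => y ^+ m.+1));
    last exact: exprn_continuous.
  by apply: cvgM; [exact: cvg_cst|exact: continuous_cos].
rewrite integral_slice_volume// Rintegral_fine_itv/=; last first.
  by move=> x; apply: cvgM; [exact: cvg_cst|exact: cfF].
by rewrite RintegralZl//; exact: continuous_integrable_itv.
Qed.

Lemma measurable_hyperplane m : measurable [set t : T m.+1 | thead t = 0].
Proof.
have := @measurable_tnth _ (measurableTypeR R) m.+1 ord0 measurableT [set 0] (measurable_set1 _).
by rewrite setTI.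
Qed.

Lemma lebesgue_tuple_hyperplane m :
  lebesgue_tuple R m.+1 [set t | thead t = 0] = 0%E.
Proof.
have mZ := @measurable_hyperplane m.
rewrite -[LHS]mul1e -integral_cst// integral_mkcond integral_lebesgue_tupleS; last 2 first.
- by apply/(measurable_restrict _ _ _) => //; exact: measurable_cst.
- by move=> t; rewrite patchE; case: ifPn.
transitivity (\int[mu]_(s in [set 0%R : R]) \int[lebesgue_tuple R m]_y
   (cst 1 \_ [set t : T m.+1 | thead t = 0%R]) (tuple_cons (s, y)))%E.
2: exact: integral_set1.
rewrite [RHS]integral_mkcond; apply: eq_integral.
move=> s _; rewrite [RHS]patchE; case: ifPn => // /negP s0.
by apply: integral0_eq => y _; rewrite patchE; case: ifPn => // /set_mem/=.
Qed.

End LebesgueTuple.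

(** * The regularized volume of a ball centred on the boundary *)

Section BallVolume.
Context {R : realType}.
Local Notation mu := (@lebesgue_measure R).
Local Notation T m := (m.-tuple (measurableTypeR R)).
Local Notation C := (R[i] : numFieldType).

Lemma cvg_at_right_div (r : R) : 0 < r -> e / r @[e --> 0^'+] --> 0^'+.
Proof.
move=> r0 A [e/= e0 eA]; exists (e * r); first by rewrite /= mulr_gt0.
move=> x /=; rewrite !sub0r !normrN => xe x0.
apply: eA; last by rewrite divr_gt0.
by rewrite /= sub0r normrN normrM normfV (gtr0_norm r0) ltr_pdivrMr.
Qed.

Lemma ccontinuous_density n (eps : R) : 0 < eps ->
  ccontinuous (fun s : R => ((s -i* eps) ^+ n)^-1).
Proof.
move=> e0; under eq_fun do rewrite -exprVn.
apply: ccontinuousX.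
have h (s : R) : s ^+ 2 + eps ^+ 2 != 0 by rewrite gt_eqF ?sum_sqr_gt0.
have cd : continuous (fun s : R => (s ^+ 2 + eps ^+ 2)^-1).
  move=> s; apply: cvgV; first exact: h.
  by apply: cvgD; [exact: exprn_continuous|exact: cvg_cst].
split=> s.
  rewrite (_ : _ \o _ = fun s => s / (s ^+ 2 + eps ^+ 2)); last first.
    by apply/funext => t; rewrite /comp inv_complex.
  by apply: cvgM; [exact: cvg_id|exact: cd].
rewrite (_ : _ \o _ = fun s => eps / (s ^+ 2 + eps ^+ 2)); last first.
  by apply/funext => t; rewrite /comp inv_complex.
by apply: cvgM; [exact: cvg_cst|exact: cd].
Qed.

(** Under s = r sin x, the density s -> (s - i eps)^-n times the volume element of
    the slices becomes the integrand of cotint, with eps / r in the place of eps: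
    this is the scale invariance of the hyperbolic volume. *)
Lemma density_polar n (r eps x : R) : 0 < r -> 0 < eps ->
  ((r * cos x) ^+ n)%:C * (((r * sin x) -i* eps) ^+ n)^-1 =
  (cos x ^+ n)%:C * cotdenom (eps / r) x ^+ n.
Proof.
move=> r0 e0; rewrite /cotdenom !rmorphXn/= -!exprVn -!exprMn; congr (_ ^+ _).
have -> : r * sin x -i* eps = r%:C * (sin x -i* (eps / r)).
  by apply/eqP; rewrite eq_complex/=; apply/andP; split; apply/eqP; field; rewrite gt_eqF.
rewrite invfM rmorphM/= mulrACA divff ?mul1r//.
by rewrite fmorph_eq0 gt_eqF.
Qed.

(** Since eps is only divided by the radius, the limit as eps tends to 0 is the
    same for all balls centred on x_0 = 0. *)
Lemma complex_integral_tball m (D : set (T m.+1)) b (c : T m) r eps :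
  0 < r -> 0 < eps ->
  (forall t, thead t <> 0 -> D t <-> tball b (tuple_cons (0, c)) (r ^+ 2) t) ->
  complex_integral D (fun t => ((tnth t ord0 -i* eps) ^+ m.+1)^-1) =
  (@ball_volume R m)%:C * cotint m.+1 m.+1 (eps / r).
Proof.
move=> r0 e0 DB; have [cr cj] := ccontinuous_density m.+1 e0.
have key (p : R[i] -> R) :
    (forall (a : R) z, p (a%:C * z) = a * p z) ->
    continuous (fun s : R => p ((s -i* eps) ^+ m.+1)^-1) ->
    \int[lebesgue_tuple R m.+1]_(t in D) p ((tnth t ord0 -i* eps) ^+ m.+1)^-1 =
    @ball_volume R m * \int[mu]_(x in `[- (pi / 2), pi / 2])
      p ((cos x ^+ m.+1)%:C * cotdenom (eps / r) x ^+ m.+1).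
  move=> pM cp; have mp := continuous_measurable_fun cp.
  rewrite [LHS]/Rintegral (@integral_sandwich _ _ _ _
    (tball b (tuple_cons (0, c)) (r ^+ 2)) _ [set t | thead t = 0])//.
  - rewrite -[LHS]/(\int[lebesgue_tuple R m.+1]_(t in _) p ((thead t -i* eps) ^+ m.+1)^-1).
    rewrite (Rintegral_tball _ _ _ r0 cp); congr (_ * _).
    apply: eq_Rintegral => x _.
    by rewrite add0r mulrC -pM density_polar.
  - exact: measurable_tball.
  - exact: measurable_hyperplane.
  - exact: lebesgue_tuple_hyperplane.
  - apply/measurable_EFinP.
    apply: (@measurableT_comp _ _ _ _ _ _
      (fun s : measurableTypeR R => p ((s -i* eps) ^+ m.+1)^-1)) => //.
    exact: measurable_tnth.
rewrite /complex_integral key//; last by move=> a [x y]; rewrite ReM/= mul0r subr0.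
rewrite key//; last by move=> a [x y]; rewrite ImM/= mul0r addr0.
by apply/eqP; rewrite eq_complex/= !mul0r subr0 addr0 !eqxx.
Qed.

Lemma complex_integral_tball_limit m (D : set (T m.+1)) b (c : T m) r :
  0 < r ->
  (forall t, thead t <> 0 -> D t <-> tball b (tuple_cons (0, c)) (r ^+ 2) t) ->
  complex_integral D (fun t => ((tnth t ord0 -i* eps) ^+ m.+1)^-1)
    @[eps --> 0^'+] --> ('i ^+ m.+1 * (pi * @ball_volume R m)%:C : C).
Proof.
move=> r0 DB.
have E : \forall e \near (0 : R)^'+,
    (@ball_volume R m)%:C * cotint m.+1 m.+1 (e / r) =
    complex_integral D (fun t => ((tnth t ord0 -i* e) ^+ m.+1)^-1).
  by near=> e; rewrite (complex_integral_tball r0 _ DB).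
apply: (cvg_at_right_eq E).
rewrite (_ : 'i ^+ _ * _ = (@ball_volume R m)%:C * ('i ^+ m.+1 * pi%:C)); last first.
  by rewrite rmorphM/=; ring.
apply: (@cvgM C); first exact: (@cvg_cst C).
have := @cotint_limit R m.+1 0.
rewrite eqxx addn0; under eq_fun do rewrite expr0 mul1r.
exact: cvg_comp (cvg_at_right_div r0).
Unshelve. all: by end_near. Qed.

End BallVolume.

(** * The area density of a hemisphere *)

Section Hemisphere.
Context {R : realType}.

(** Two block factorizations of the block matrix with rows (1, - v) and (u, 1). *)
Lemma det_rank1 n (u : 'cV[R]_n) (v : 'rV[R]_n) :
  \det (1%:M + u *m v) = 1 + (v *m u) 0 0.
Proof.
have E : block_mx 1%:M 0 u 1%:M *m block_mx 1%:M (- v) 0 (1%:M + u *m v) =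
         block_mx 1%:M (- v) 0 1%:M *m block_mx (1%:M + v *m u) 0 u 1%:M.
  rewrite !mulmx_block !mul1mx !mulmx1 !mul0mx ?mulmx0 !addr0 !add0r.
  by rewrite mulNmx addrK mulmxN addrC addrK.
have := congr1 determinant E.
rewrite !det_mulmx !det_lblock !det_ublock !det1 !mul1r mulr1 => ->.
by rewrite [_ + _]mx11_scalar det_scalar1 !mxE eqxx.
Qed.

Lemma is_diff_sum_seq (V W : normedModType R) (I : Type) (r : seq I)
    (f df : I -> V -> W) (x : V) :
  (forall i, is_diff x (f i) (df i)) ->
  is_diff x (fun y => \sum_(i <- r) f i y) (fun h => \sum_(i <- r) df i h).
Proof.
move=> dfi; elim: r => [|i r IH].
  have e0 (g : I -> V -> W) : (fun y => \sum_(i <- [::]) g i y) = cst 0.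
    by apply/funext => y; rewrite big_nil.
  by rewrite !e0; exact: is_diff_cst.
have e1 (g : I -> V -> W) : (fun y => \sum_(j <- i :: r) g j y) =
    g i + (fun y => \sum_(j <- r) g j y).
  by apply/funext => y; rewrite big_cons.
by rewrite !e1; exact: is_diffD.
Qed.

Lemma is_diff_coord n (x : 'rV[R]_n) j :
  is_diff x (fun y : 'rV[R]_n => y 0 j : R) (fun h => h 0 j).
Proof.
have d := @differentiable_coord R 1 n x 0 j.
apply: DiffDef => //.
pose f (y : 'rV[R]_n) : R := y 0 j.
have flin : linear f by move=> a y z; rewrite /f !mxE.
pose F : {linear 'rV[R]_n -> R} := HB.pack f (GRing.isLinear.Build _ _ _ _ _ flin).
rewrite (_ : (fun y : 'rV[R]_n => y 0 j) = F)//.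
by rewrite diff_lin// => y; apply: differentiable_continuous; exact: differentiable_coord.
Qed.

Lemma is_diffZl (V W : normedModType R) (k dk : V -> R) (w : W) (x : V) :
  is_diff x k dk -> is_diff x (fun y => k y *: w) (fun h => dk h *: w).
Proof.
move=> dkx; have dx := @ex_diff _ _ _ _ _ _ _ dkx.
apply: DiffDef; first exact: differentiableZl.
by rewrite diffZl// diff_val.
Qed.

Lemma is_diff_sqrt (V : normedModType R) (q dq : V -> R) (x : V) : 0 < q x ->
  is_diff x q dq ->
  is_diff x (fun y => Num.sqrt (q y)) (fun h => dq h / (2 * Num.sqrt (q x))).
Proof.
move=> q0 dqx.
have d1 := is_derive1_sqrt q0.
have d2 : is_diff (q x) (@Num.sqrt R) (fun h => h *: (2 * Num.sqrt (q x))^-1).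
  have dd : differentiable (@Num.sqrt R) (q x) by apply/derivable1_diffP; case: d1.
  apply: DiffDef => //; rewrite diff1E// derive1E.
  by apply/funext => h; rewrite /=; have [_ ->] := d1.
exact: (is_diff_comp dqx d2).
Qed.

Lemma is_diff_sqnorm n (x : 'rV[R]_n) :
  is_diff x (@sqnorm R n) (fun h => \sum_j 2 * x 0 j * h 0 j).
Proof.
rewrite /sqnorm; apply: is_diff_sum_seq => j.
have := is_diff_coord x j => dj.
rewrite (_ : (fun y : 'rV[R]_n => y 0 j ^+ 2) = (fun y : 'rV[R]_n => y 0 j) ^+ 2)//.
apply: (is_diff_eq (is_diffX 1 dj)).
by apply/funext => h; rewrite /= expr1.
Qed.

(** The differential is written with basis vectors because the entries of the
    Jacobian are its coordinates on them. *)
Lemma is_diff_hemisphere n s (x : 'rV[R]_n) : sqnorm x < 1 ->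
  is_diff x (hemisphere s) (fun h =>
    (- (s * (\sum_j x 0 j * h 0 j)) / Num.sqrt (1 - sqnorm x)) *: delta_mx 0 0 +
    \sum_j h 0 j *: delta_mx 0 (lift ord0 j)).
Proof.
move=> x1; have q0 : 0 < 1 - sqnorm x by rewrite subr_gt0.
rewrite (_ : hemisphere s = (fun y => (s * Num.sqrt (1 - sqnorm y)) *: delta_mx 0 0) +
   (fun y : 'rV[R]_n => \sum_j y 0 j *: delta_mx 0 (lift ord0 j))); last first.
  apply/funext => y; rewrite /hemisphere; apply/rowP => k.
  case: (unliftP ord0 k) => [j ->|->].
    rewrite (_ : lift ord0 j = rshift 1 j); last exact: val_inj.
    transitivity (y 0 j); first exact: row_mxEr.
    rewrite fctE !mxE summxE/= mulr0 add0r (bigD1 j)//= !mxE eqxx/=.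
    rewrite (_ : rshift 1 j == lift ord0 j) ?mulr1; last exact/eqP/val_inj.
    rewrite big1 ?addr0// => i ij; rewrite !mxE/=.
    rewrite (_ : rshift 1 j == lift ord0 i = false) ?mulr0//.
    by apply/negbTE; apply: contra ij => /eqP/(congr1 val)/= [] /val_inj ->.
  rewrite (_ : ord0 = lshift n (0 : 'I_1)); last exact: val_inj.
  transitivity ((s * Num.sqrt (1 - sqnorm y))%:M 0 (0 : 'I_1)); first exact: row_mxEl.
  rewrite fctE !mxE summxE eqxx mulr1n/= mulr1 big1 ?addr0// => i _.
  by rewrite !mxE mulr0.
apply: is_diffD.
  apply: is_diffZl.
  have dq : is_diff x (fun y : 'rV[R]_n => 1 - sqnorm y)
      (fun h => - \sum_j 2 * x 0 j * h 0 j).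
    apply: (is_diff_eq (is_diffB (is_diff_cst (1 : R) x) (is_diff_sqnorm x))).
    by apply/funext => h; rewrite /= fctE/= sub0r.
  rewrite (_ : (fun y => s * Num.sqrt (1 - sqnorm y)) =
     s *: (fun y : 'rV[R]_n => Num.sqrt (1 - sqnorm y)))//.
  apply: (is_diff_eq (is_diffZ s
    (@is_diff_sqrt _ (fun y : 'rV[R]_n => 1 - sqnorm y) _ x q0 dq))).
  apply/funext => h.
  rewrite fctE /= /GRing.scale/=.
  under eq_bigr do rewrite -mulrA.
  rewrite -mulr_sumr.
  have h0 : Num.sqrt (1 - sqnorm x) != 0 by rewrite gt_eqF ?sqrtr_gt0.
  by field.
apply: is_diff_sum_seq => j; apply: is_diffZl; exact: is_diff_coord.
Qed.

(** The Jacobian is a column u followed by the identity, so that the Gram matrix is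
    1 + u u^T, of determinant 1 + |u|^2 with |u|^2 = |x|^2 / (1 - |x|^2). *)
Lemma gram_hemisphere n s (x : 'rV[R]_n) : sqnorm x < 1 -> s ^+ 2 = 1 ->
  \det (jacobian (hemisphere s) x *m (jacobian (hemisphere s) x)^T) =
  (1 - sqnorm x)^-1.
Proof.
move=> x1 s1; have q0 : 0 < 1 - sqnorm x by rewrite subr_gt0.
have dh := is_diff_hemisphere s x1.
pose u : 'cV[R]_n := \col_i (- (s * x 0 i) / Num.sqrt (1 - sqnorm x)).
have -> : jacobian (hemisphere s) x = row_mx u 1%:M.
  apply/matrixP => i k; rewrite /jacobian mxE diff_val.
  have sE : \sum_j x 0 j * (delta_mx 0 i : 'rV[R]_n) 0 j = x 0 i.
    rewrite (bigD1 i)//= mxE !eqxx mulr1 big1 ?addr0// => j ji.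
    by rewrite mxE/= (negbTE ji) mulr0.
  rewrite sE [LHS]mxE [X in X + _ = _]mxE [X in _ * X + _]mxE summxE.
  case: (unliftP ord0 k) => [j ->|->].
    rewrite (_ : lift ord0 j = rshift 1 j); last exact: val_inj.
    transitivity ((1%:M : 'M[R]_n) i j); last by apply/esym; exact: row_mxEr.
    rewrite (bigD1 j)//= !mxE eqxx/= mulr0 add0r eq_sym.
    rewrite (_ : rshift 1 j == lift ord0 j) ?mulr1; last exact/eqP/val_inj.
    rewrite big1 ?addr0// => l lj; rewrite !mxE/=.
    rewrite (_ : rshift 1 j == lift ord0 l = false) ?mulr0//.
    by apply/negbTE; apply: contra lj => /eqP/(congr1 val)/= [] /val_inj ->.
  rewrite (_ : ord0 = lshift n (0 : 'I_1)); last exact: val_inj.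
  transitivity (u i 0); last by apply/esym; exact: row_mxEl.
  by rewrite !mxE eqxx mulr1 big1 ?addr0// => l _; rewrite !mxE mulr0.
have E : row_mx u 1%:M *m (row_mx u 1%:M)^T = 1%:M + u *m u^T.
  by rewrite tr_row_mx mul_row_col trmx1 mulmx1 addrC.
transitivity (\det (1%:M + u *m u^T)); first by rewrite -E.
rewrite det_rank1 mxE.
rewrite (eq_bigr (fun j => (1 - sqnorm x)^-1 * x 0 j ^+ 2)); last first.
  move=> j _; rewrite !mxE -expr2 expr_div_n sqr_sqrtr ?ltW// sqrrN exprMn s1 mul1r.
  by rewrite mulrC.
rewrite -mulr_sumr -/(sqnorm x).
have h0 := gt_eqF q0.
by field; rewrite h0.
Qed.

End Hemisphere.

(** * The volume of the sphere *)

Section SphereVolume.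
Context {R : realType}.
Local Notation mu := (@lebesgue_measure R).
Local Notation T m := (m.-tuple (measurableTypeR R)).

(** The formula x * (x^2)^-1 reduces inversion to a power of a nonnegative
    number. *)
Lemma measurable_inv : measurable_fun setT (@GRing.inv R : R -> R).
Proof.
rewrite (_ : GRing.inv = fun x : R => x * (x ^+ 2) `^ (-1)).
  apply: measurable_funM => //.
  apply: (@measurableT_comp _ _ _ _ _ _ (fun x : R => x `^ (-1))); first exact: measurable_powR.
  exact: exprn_measurable.
apply/funext => x; rewrite powR_inv1 ?sqr_ge0//.
have [->|x0] := eqVneq x 0; first by rewrite invr0 mul0r.
by rewrite expr2 invfM mulrA divff// mul1r.
Qed.

(** Angles that increase to a right angle: the density of a half circle is
    unbounded at its ends, and the integral is taken over smaller arcs first. *)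
Definition arc_angle (k : nat) : R := pi / 2 * (1 - k.+1%:R^-1).

Lemma arc_angle_ge0 k : 0 <= arc_angle k.
Proof.
rewrite mulr_ge0 ?divr_ge0 ?pi_ge0// subr_ge0 invf_le1 ?ltr0n//.
by rewrite ler1n.
Qed.

Lemma arc_angle_lt k : arc_angle k < pi / 2.
Proof.
by rewrite gtr_pMr ?divr_gt0 ?pi_gt0// gtrBl invr_gt0.
Qed.

Lemma arc_angle_nd : {homo arc_angle : k l / (k <= l)%N >-> k <= l}.
Proof.
move=> k l kl; rewrite ler_pM2l ?divr_gt0 ?pi_gt0// lerD2l lerN2.
by rewrite lef_pV2 ?posrE// ler_nat.
Qed.

Lemma cvg_arc_angle : arc_angle k @[k --> \oo] --> (pi / 2 : R).
Proof.
rewrite -[X in _ --> X]mulr1 -[X in _ * X]subr0.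
apply: cvgM; first exact: cvg_cst.
by apply: cvgB; [exact: cvg_cst|exact: cvg_harmonic].
Qed.

Lemma arc_angle_itv k x : - arc_angle k <= x <= arc_angle k -> - (pi / 2) < x < pi / 2.
Proof.
move=> /andP[h1 h2]; rewrite (le_lt_trans h2) ?arc_angle_lt// andbT.
by apply: lt_le_trans h1; rewrite ltrN2 arc_angle_lt.
Qed.

Lemma integral_arc (a : R) k : 0 < a ->
  (\int[mu]_(s in `[(- (a * sin (arc_angle k)))%R, (a * sin (arc_angle k))%R])
     (Num.sqrt ((a ^+ 2 - s ^+ 2)^-1))%:E = (arc_angle k *+ 2)%:E)%E.
Proof.
move=> a0.
pose F (x : R) := a * sin x.
have dF (x : R) : is_derive x (1 : R) F (a * cos x).
  by apply: is_derive_eq; rewrite /GRing.scale/=; ring.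
have F'E : derive1 F = fun x => a * cos x.
  by apply/funext => x; rewrite derive1E; have [] := dF x.
have cF x : {for x, continuous F}.
  by apply: differentiable_continuous; apply/derivable1_diffP; have [] := dF x.
have cF' x : {for x, continuous (derive1 F)}.
  by rewrite F'E; apply: cvgM; [exact: cvg_cst|exact: continuous_cos].
have FN : - (a * sin (arc_angle k)) = F (- arc_angle k) by rewrite /F sinN mulrN.
rewrite FN -/(F _).
have lek : - arc_angle k <= arc_angle k by rewrite (@le_trans _ _ 0) ?oppr_le0 ?arc_angle_ge0.
have incF : {in `[- arc_angle k, arc_angle k] &, {homo F : x y / x < y}}.
  move=> x y; rewrite !in_itv/= => /arc_angle_itv/andP[x1 x2] /arc_angle_itv/andP[y1 y2] xy.
  by rewrite /F ltr_pM2l// ltr_sin ?in_itv/= ?x1 ?x2 ?y1 ?y2 ?ltW.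
rewrite (@integration_by_substitution_increasing _ F (fun s => Num.sqrt ((a ^+ 2 - s ^+ 2)^-1)))//.
- transitivity (\int[mu]_(x in `[(- arc_angle k)%R, arc_angle k]) (cst 1 x))%E.
    apply: eq_integral => x; rewrite inE/= in_itv/= => xI; congr EFin.
    rewrite F'E [LHS](_ : _ = Num.sqrt ((a ^+ 2 - F x ^+ 2)^-1) * (a * cos x))//.
    have c0 : 0 < a * cos x by rewrite mulr_gt0// cos_gt0_pihalf// (arc_angle_itv xI).
    have -> : a ^+ 2 - F x ^+ 2 = (a * cos x) ^+ 2.
      by rewrite [in RHS]exprMn cos2sin2 /F; ring.
    by rewrite sqrtrV ?sqr_ge0// sqrtr_sqr gtr0_norm// mulVf ?gt_eqF.
  rewrite integral_cst// mul1e /= lebesgue_measure_itv/= lte_fin.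
  case: ifPn => [_|]; first by rewrite -EFinD opprK mulr2n.
  rewrite -leNgt => h; have -> : arc_angle k = 0; last by rewrite mul0rn.
  by apply/eqP; rewrite eq_le arc_angle_ge0 andbT; have := arc_angle_ge0 k; lra.
- by move=> x _; exact: cF'.
- by apply/cvg_ex; eexists; exact: cvg_at_right_filter (cF' _).
- by apply/cvg_ex; eexists; exact: cvg_at_left_filter (cF' _).
- split; first by move=> x _; have [] := dF x.
  + exact: cvg_at_right_filter (cF _).
  + exact: cvg_at_left_filter (cF _).
- apply: continuous_in_subspaceT => s; rewrite inE/= in_itv/= => sI.
  apply: (@cvg_comp _ _ _ (fun s => (a ^+ 2 - s ^+ 2)^-1) (@Num.sqrt R)); last exact: sqrt_continuous.
  apply: cvgV; last by apply: cvgB; [exact: cvg_cst|exact: exprn_continuous].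
  rewrite gt_eqF// subr_gt0 -[ltLHS]real_normK ?num_real// ltr_sqr ?nnegrE ?(ltW a0)//.
  have s1 : sin (arc_angle k) < 1.
    rewrite -sin_pihalf ltr_sin ?in_itv/= ?arc_angle_lt//.
      rewrite (ltW (arc_angle_lt k)) andbT (@le_trans _ _ 0) ?arc_angle_ge0//.
      by rewrite oppr_le0 divr_ge0 ?pi_ge0.
    by rewrite lexx andbT ltW// Npihalf_lt_pihalf.
  have : F (arc_angle k) < a by rewrite /F gtr_pMr.
  apply: le_lt_trans; rewrite ler_norml.
  by rewrite -FN in sI.
Qed.

(** A half circle of radius a, parametrized by its diameter, has length a pi; the
    density here lacks the factor a. *)
Lemma integral_arcsine (a : R) : 0 < a ->
  (\int[mu]_(s in `](- a)%R, a[) (Num.sqrt ((a ^+ 2 - s ^+ 2)^-1))%:E = pi%:E)%E.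
Proof.
move=> a0.
pose F k : set R := `[- (a * sin (arc_angle k)), a * sin (arc_angle k)]%classic.
have arcI k : arc_angle k \in `[- (pi / 2), pi / 2].
  rewrite in_itv/= (ltW (arc_angle_lt k)) andbT (@le_trans _ _ 0) ?arc_angle_ge0//.
  by rewrite oppr_le0 divr_ge0 ?pi_ge0.
have pI : (pi / 2 : R) \in `[- (pi / 2), pi / 2].
  by rewrite in_itv/= lexx andbT ltW// Npihalf_lt_pihalf.
have s1 k : sin (arc_angle k) < 1 by rewrite -sin_pihalf ltr_sin ?arc_angle_lt.
have UF : \bigcup_k F k = `]- a, a[%classic.
  apply/seteqP; split => s.
    move=> [k _]; rewrite /F /= !in_itv/= => /andP[h1 h2].
    have sa : a * sin (arc_angle k) < a by rewrite gtr_pMr.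
    by rewrite (le_lt_trans h2)// andbT (lt_le_trans _ h1)// ltrN2.
  rewrite /= in_itv/= => /andP[h1 h2].
  have sa : `|s / a| < 1.
    by rewrite normrM normfV (gtr0_norm a0) ltr_pdivrMr// mul1r ltr_norml h1 h2.
  have : sin (arc_angle k) @[k --> \oo] --> (1 : R).
    rewrite -sin_pihalf; apply: continuous_cvg; last exact: cvg_arc_angle.
    exact: continuous_sin.
  move=> /cvgr_gt /(_ _ sa) [k _ /(_ k (leqnn k))] hk; exists k => //.
  rewrite /F/= in_itv/= -ler_norml.
  move: hk; rewrite normrM normfV (gtr0_norm a0) ltr_pdivrMr// mulrC.
  exact: ltW.
have msqrt : measurable_fun setT (fun s : R => Num.sqrt ((a ^+ 2 - s ^+ 2)^-1)).
  apply: (@measurableT_comp _ _ _ _ _ _ (@Num.sqrt R)).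
    by apply: continuous_measurable_fun; exact: sqrt_continuous.
  apply: (@measurableT_comp _ _ _ _ _ _ (@GRing.inv R)); first exact: measurable_inv.
  by apply: measurable_funB => //; exact: exprn_measurable.
have lesin k l : (k <= l)%N -> a * sin (arc_angle k) <= a * sin (arc_angle l).
  by move=> kl; rewrite ler_pM2l// leNgt ltr_sin// -leNgt arc_angle_nd.
have := @ge0_nondecreasing_set_cvg_integral _ (measurableTypeR R) R F
  (fun s => (Num.sqrt ((a ^+ 2 - s ^+ 2)^-1))%:E)
  [the measure (measurableTypeR R) R of @lebesgue_measure R].
have nd : nondecreasing_seq F.
  apply/nondecreasing_seqP => k; rewrite subsetEset; apply: subset_itv; rewrite bnd_simp.
    by rewrite lerN2 lesin.
  by rewrite lesin.
have mF k : measurable (F k : set (measurableTypeR R)) by exact: measurable_itv.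
move=> /(_ nd mF _ _)/cvg_lim; rewrite UF => <- //.
- apply/cvg_lim => //.
  under eq_fun do rewrite integral_arc//.
  apply: cvg_EFin; first exact: nearW.
  rewrite [X in _ --> X](_ : pi = (pi / 2) *+ 2); last by rewrite mulr2n -splitr.
  by apply: cvgMn; exact: cvg_arc_angle.
- by move=> k; exact/measurable_EFinP/measurable_funTS.
Qed.

(** Over the chord through y parallel to the first axis, the density is that of a
    half circle and integrates to pi for each y of the unit ball of dimension m,
    whatever the length of the chord. *)
Lemma integral_ball_density m :
  (\int[lebesgue_tuple R m.+1]_(t in
      [set t : T m.+1 | (\sum_(j < m.+1) tnth t j ^+ 2 < 1)%R])
     (Num.sqrt ((1 - \sum_(j < m.+1) tnth t j ^+ 2)^-1))%:E =
   (pi * ball_volume m)%:E)%E.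
Proof.
pose q k (t : T k) : R := \sum_(j < k) tnth t j ^+ 2.
pose g k (t : T k) : \bar R := (Num.sqrt ((1 - q k t)^-1))%:E.
have mq k : measurable_fun setT (q k).
  apply: measurable_sum => j; apply: measurable_funX; exact: measurable_tnth.
have mD k : measurable [set t : T k | q k t < 1].
  have := mq k measurableT `]-oo, 1[%classic (measurable_itv _); rewrite setTI.
  by congr measurable; apply/seteqP; split => t /=; rewrite in_itv.
have mg k : measurable_fun setT (g k).
  apply/measurable_EFinP.
  apply: (@measurableT_comp _ _ _ _ _ _ (@Num.sqrt R)).
    by apply: continuous_measurable_fun; exact: sqrt_continuous.
  apply: (@measurableT_comp _ _ _ _ _ _ (@GRing.inv R)); first exact: measurable_inv.
  by apply: measurable_funB => //; exact: mq.
have qS (s : R) (y : T m) : q m.+1 (tuple_cons (s, y)) = s ^+ 2 + q m y.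
  rewrite /q big_ord_recl tnth0; congr (_ + _).
  by apply: eq_bigr => j _; rewrite tnthS.
have ballE : [set y : T m | q m y < 1] = tball false [tuple of nseq m 0] (1 ^+ 2).
  apply/seteqP; split => y; rewrite /tball/= expr1n /q.
    by under [X in _ -> is_true (X < _)]eq_bigr do rewrite tnth_nseq subr0.
  by under [X in is_true (X < _) -> _]eq_bigr do rewrite tnth_nseq subr0.
rewrite -[LHS]/(\int[lebesgue_tuple R m.+1]_(t in [set t : T m.+1 | (q m.+1 t < 1)%R]) g m.+1 t)%E.
rewrite integral_mkcond integral_lebesgue_tupleS_swap; last 2 first.
- apply/(measurable_restrict _ _ _) => //; first exact: mD.
  by apply: (@measurable_funS _ _ _ _ setT) => //; exact: mg.
- by move=> t; rewrite patchE; case: ifPn => // _; rewrite lee_fin sqrtr_ge0.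
transitivity (\int[lebesgue_tuple R m]_(y in [set y : T m | (q m y < 1)%R]) (cst pi%:E) y)%E.
  rewrite [RHS]integral_mkcond; apply: eq_integral => y _; rewrite [RHS]patchE.
  case: ifPn => [/set_mem/= qy|/negP qy].
    pose a := Num.sqrt (1 - q m y).
    have a0 : 0 < a by rewrite sqrtr_gt0 subr_gt0.
    have a2 : a ^+ 2 = 1 - q m y by rewrite sqr_sqrtr// subr_ge0 ltW.
    rewrite -(integral_arcsine a0) [RHS]integral_mkcond.
    apply: eq_integral => s _; rewrite !patchE a2.
    have -> : (tuple_cons (s, y) \in [set t : T m.+1 | q m.+1 t < 1]) =
      (s \in (`](- a), a[%classic : set R)).
      have -> : (s \in (`](- a), a[%classic : set R)) = (s ^+ 2 < a ^+ 2).
        rewrite -[s ^+ 2]real_normK ?num_real// ltr_sqr ?nnegrE ?normr_ge0 ?(ltW a0)//.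
        by apply/idP/idP; rewrite inE/= in_itv/= ltr_norml.
      by apply/idP/idP; rewrite inE/= qS a2 ltrBrDr.
    by case: ifPn => // _; rewrite /g qS; congr ((Num.sqrt (_ ^-1))%:E); ring.
  apply: integral0_eq => s _; rewrite patchE; case: ifPn => // /set_mem/=; rewrite qS => h.
  exfalso; apply: qy; apply/mem_set => /=; apply: le_lt_trans h.
  by rewrite lerDr sqr_ge0.
have E := @ball_volume_correct R m false [tuple of nseq m 0] 1 ltr01.
rewrite -ballE expr1n mulr1 in E.
rewrite integral_cst; last exact: mD.
exact: (congr1 (fun z : \bar R => pi%:E * z)%E E).
Qed.

Lemma sphere_volume_ball m : sphere_volume R m.+1 = pi * @ball_volume R m *+ 2.
Proof.
have key (s : R) : s ^+ 2 = 1 ->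
    parametrized_volume [set x : 'rV[R]_m.+1 | sqnorm x < 1] (hemisphere s) =
    pi * ball_volume m.
  move=> s1; rewrite /parametrized_volume /Rintegral.
  have qE (t : T m.+1) : sqnorm (row_of_tuple t) = \sum_(j < m.+1) tnth t j ^+ 2.
    by rewrite /sqnorm; apply: eq_bigr => j _; rewrite mxE.
  have -> : [set t : T m.+1 | [set x : 'rV[R]_m.+1 | sqnorm x < 1] (row_of_tuple t)] =
      [set t : T m.+1 | \sum_(j < m.+1) tnth t j ^+ 2 < 1].
    by apply/seteqP; split => t /=; rewrite qE.
  rewrite -[RHS]/(fine (pi * ball_volume m)%:E) -integral_ball_density; congr fine.
  apply: eq_integral => t /set_mem/= t1.
  by rewrite gram_hemisphere ?qE.
by rewrite /sphere_volume !key ?mulr2n// ?sqrrN ?expr1n.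
Qed.

Lemma sphere_volume0 : sphere_volume R 0 = 2.
Proof.
have key (s : R) : parametrized_volume [set x : 'rV[R]_0 | sqnorm x < 1] (hemisphere s) = 1.
  rewrite /parametrized_volume.
  rewrite (_ : [set t : T 0 | _ ] = setT); last first.
    by apply/seteqP; split => t //= _; rewrite /sqnorm big_ord0.
  rewrite (@eq_Rintegral _ _ _ _ _ (cst 1)); last by move=> t _; rewrite det_mx00 sqrtr1.
  have E : lebesgue_tuple R 0 setT = 1%E by exact: diracT.
  by rewrite Rintegral_cst// mul1r; exact: (congr1 fine E).
by rewrite /sphere_volume !key.
Qed.

End SphereVolume.

(** * Isometries and half-spaces *)

Section Lorentz.
Context {R : realType}.

Lemma lorentzC n (x y : 'rV[R]_n.+1) : lorentz x y = lorentz y x.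
Proof.
rewrite /lorentz mulrC; congr (_ + _).
by apply: eq_bigr => j _; rewrite mulrC.
Qed.

Lemma lorentzDl n (x y z : 'rV[R]_n.+1) :
  lorentz (x + y) z = lorentz x z + lorentz y z.
Proof.
rewrite /lorentz !mxE.
under eq_bigr do rewrite !mxE mulrDl.
by rewrite big_split/=; ring.
Qed.

Lemma lorentzZl n a (x z : 'rV[R]_n.+1) : lorentz (a *: x) z = a * lorentz x z.
Proof.
rewrite /lorentz !mxE.
under eq_bigr do rewrite !mxE -mulrA.
by rewrite -mulr_sumr; ring.
Qed.

Lemma lorentzDr n (x y z : 'rV[R]_n.+1) :
  lorentz z (x + y) = lorentz z x + lorentz z y.
Proof. by rewrite lorentzC lorentzDl !(lorentzC z). Qed.

Lemma lorentzZr n a (x z : 'rV[R]_n.+1) : lorentz z (a *: x) = a * lorentz z x.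
Proof. by rewrite lorentzC lorentzZl (lorentzC z). Qed.

Lemma lorentzNl n (x z : 'rV[R]_n.+1) : lorentz (- x) z = - lorentz x z.
Proof. by rewrite -scaleN1r lorentzZl mulN1r. Qed.

Lemma lorentzNr n (x z : 'rV[R]_n.+1) : lorentz z (- x) = - lorentz z x.
Proof. by rewrite lorentzC lorentzNl lorentzC. Qed.

Lemma lorentz_self n (x : 'rV[R]_n.+1) :
  lorentz x x = - x 0 0 ^+ 2 + \sum_(j < n) x 0 (lift ord0 j) ^+ 2.
Proof. by rewrite /lorentz expr2. Qed.

(** The reversed Cauchy-Schwarz inequality.  The sum over j of
    (x_j y_0 - y_j x_0)^2 is 2 x_0 y_0 c - x_0^2 - y_0^2, where c = - x.y; as it is
    nonnegative, 2 x_0 y_0 c >= x_0^2 + y_0^2 >= 2 x_0 y_0. *)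
Lemma hyp_lorentz_ge1 n (x y : 'rV[R]_n.+1) : hyp x -> hyp y ->
  1 <= - lorentz x y.
Proof.
move=> [xx x0] [yy y0]; set c := - lorentz x y.
have sq : 0 <= \sum_(j < n) (x 0 (lift ord0 j) * y 0 0 - y 0 (lift ord0 j) * x 0 0) ^+ 2.
  by apply: sumr_ge0 => j _; exact: sqr_ge0.
have E : \sum_(j < n) (x 0 (lift ord0 j) * y 0 0 - y 0 (lift ord0 j) * x 0 0) ^+ 2 =
   2 * (x 0 0 * y 0 0) * c - x 0 0 ^+ 2 - y 0 0 ^+ 2.
  transitivity (y 0 0 ^+ 2 * (\sum_(j < n) x 0 (lift ord0 j) ^+ 2) +
     x 0 0 ^+ 2 * (\sum_(j < n) y 0 (lift ord0 j) ^+ 2) -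
     2 * (x 0 0 * y 0 0) * (\sum_(j < n) x 0 (lift ord0 j) * y 0 (lift ord0 j))).
    rewrite !mulr_sumr -big_split/= -sumrB; apply: eq_bigr => j _; ring.
  have -> : \sum_(j < n) x 0 (lift ord0 j) ^+ 2 = x 0 0 ^+ 2 - 1.
    by move: xx; rewrite lorentz_self => /eqP; rewrite addrC subr_eq => /eqP ->; ring.
  have -> : \sum_(j < n) y 0 (lift ord0 j) ^+ 2 = y 0 0 ^+ 2 - 1.
    by move: yy; rewrite lorentz_self => /eqP; rewrite addrC subr_eq => /eqP ->; ring.
  by rewrite /c /lorentz; ring.
rewrite {}E in sq.
have p0 : 0 < x 0 0 * y 0 0 by rewrite mulr_gt0.
have : 2 * (x 0 0 * y 0 0) <= 2 * (x 0 0 * y 0 0) * c.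
  by have := sqr_ge0 (x 0 0 - y 0 0); nra.
by rewrite ler_pMr// mulr_gt0.
Qed.

Lemma arcosh_inj (s t : R) : 1 <= s -> 1 <= t -> arcosh s = arcosh t -> s = t.
Proof.
have pos (u : R) : 1 <= u -> 0 < u + Num.sqrt (u ^+ 2 - 1).
  by move=> u1; rewrite ltr_pwDl ?sqrtr_ge0// (lt_le_trans ltr01).
have mono (u w : R) : 1 <= u -> u < w -> u + Num.sqrt (u ^+ 2 - 1) < w + Num.sqrt (w ^+ 2 - 1).
  move=> u1 uw; apply: ltr_leD => //; apply: ler_wsqrtr; rewrite lerD2r.
  by rewrite ler_sqr ?nnegrE ?(le_trans ler01)// ltW// (le_lt_trans u1).
move=> s1 t1; rewrite /arcosh => /ln_inj; rewrite !posrE !pos// => /(_ isT isT) E.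
have [st|ts|//] := ltgtP s t.
  by have := mono _ _ s1 st; rewrite E ltxx.
by have := mono _ _ t1 ts; rewrite E ltxx.
Qed.

(** The distance determines - x.y because arcosh is injective on [1, oo[, where
    hyp_lorentz_ge1 puts this number. *)
Lemma DH_isometry_lorentz n (g : 'rV[R]_n.+1 -> 'rV[R]_n.+1) x y :
  DH_isometry g -> hyp x -> hyp y -> lorentz (g x) (g y) = lorentz x y.
Proof.
move=> [[gh _ _] gd _ _ _] hx hy; apply: oppr_inj.
apply: arcosh_inj; [|exact: hyp_lorentz_ge1|exact: gd].
by apply: hyp_lorentz_ge1; exact: gh.
Qed.

(** The points of P at infinity are left arbitrary: they do not contribute to the
    volume. *)
Definition half_space_like n (P : set 'rV[R]_n.+1) b (v : 'rV[R]_n.+1) :=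
  [/\ forall x, hyp x -> (P x <-> lorentz x v < 0 ?<= if b),
      forall x, hyp x -> (P (- x) <-> lorentz x v < 0 ?<= if b) &
      forall x, P x -> [\/ hyp x, hyp (- x) | hyp_boundary x]].

Definition origin n : 'rV[R]_n.+1 := delta_mx 0 0.

Lemma lorentz_origin n (x : 'rV[R]_n.+1) : lorentz x (origin n) = - x 0 0.
Proof.
rewrite /lorentz /origin !mxE !eqxx/= mulr1 big1 ?addr0// => j _.
by rewrite !mxE/= mulr0.
Qed.

Lemma hyp_origin n : hyp (origin n).
Proof. by split; rewrite ?lorentz_origin /origin mxE !eqxx. Qed.

(** Adding a large multiple of the origin makes any vector timelike and
    future-directed.  Only this form of the fact that H^n spans the ambient space is
    needed to transport a normal vector by an isometry. *)
Lemma hyp_decomposition n (v : 'rV[R]_n.+1) : 0 < lorentz v v ->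
  exists k s p, hyp p /\ v = k *: p - s *: origin n.
Proof.
move=> v0.
pose s := 1 + 2 * `|v 0 0| + lorentz v v.
pose u := v + s *: origin n.
have u0 : u 0 0 = v 0 0 + s by rewrite /u !mxE !eqxx mulr1.
have n0 := normr_ge0 (v 0 0).
have vn : - v 0 0 <= `|v 0 0| by rewrite -normrN ler_norm.
have s1 : 1 <= s by rewrite /s; lra.
have uu : lorentz u u = lorentz v v - s * (s + 2 * v 0 0).
  rewrite /u !lorentzDl !lorentzDr !lorentzZl !lorentzZr [lorentz (origin n) v]lorentzC.
  by rewrite !lorentz_origin /origin mxE !eqxx/=; ring.
have uu0 : lorentz u u < 0.
  rewrite uu subr_lt0; apply: (@lt_le_trans _ _ (1 * (s + 2 * v 0 0))); last first.
    by apply: ler_wpM2r => //; rewrite /s; lra.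
  by rewrite mul1r /s; lra.
pose k := Num.sqrt (- lorentz u u).
have k0 : 0 < k by rewrite sqrtr_gt0 oppr_gt0.
have k2 : k ^+ 2 = - lorentz u u by rewrite sqr_sqrtr// oppr_ge0 ltW.
(* k normalizes u to Lorentz square -1 *)
exists k, s, (k^-1 *: u); split; last first.
  by rewrite scalerA divff ?gt_eqF// scale1r /u addrK.
split; last by rewrite mxE mulr_gt0 ?invr_gt0// u0 /s; lra.
rewrite lorentzZl lorentzZr mulrA -expr2 exprVn -[lorentz u u]opprK -k2.
by rewrite mulrN mulVf// expf_neq0// gt_eqF.
Qed.

Lemma hyp_not_neg n (x : 'rV[R]_n.+1) : hyp x -> ~ hyp (- x).
Proof. by move=> [_ x0] [_]; rewrite mxE oppr_gt0 => /(lt_trans x0); rewrite ltxx. Qed.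

Lemma hyp_not_boundary n (x : 'rV[R]_n.+1) : hyp x -> ~ hyp_boundary x.
Proof. by move=> [xx _] [+ _]; rewrite xx => /eqP; rewrite oppr_eq0 oner_eq0. Qed.

Lemma hyp_opp_not_boundary n (x : 'rV[R]_n.+1) : hyp x -> ~ hyp_boundary (- x).
Proof.
move=> [xx _] []; rewrite lorentzNl lorentzNr opprK xx => /eqP.
by rewrite oppr_eq0 oner_eq0.
Qed.

(** An isometry is not known to be linear, but it preserves the products of points
    of H^n.  Writing v = k p - s e with p and e in H^n, the vector
    v' = k g(p) - s g(e) satisfies g(x).v' = x.v for all x in H^n. *)
Lemma isometry_half_space n (g : 'rV[R]_n.+1 -> 'rV[R]_n.+1) b v :
  DH_isometry g -> 0 < lorentz v v ->
  exists2 v', 0 < lorentz v' v' & half_space_like (g @` half_space b v) b v'.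
Proof.
move=> ig v0; have [k [s [p [hp vE]]]] := hyp_decomposition v0.
have he := hyp_origin n.
have gl x y := @DH_isometry_lorentz n g x y ig.
have [[gh gi gs] gd gN gb _] := ig.
pose v' := k *: g p - s *: g (origin n).
have v'E x : hyp x -> lorentz (g x) v' = lorentz x v.
  by move=> hx; rewrite /v' vE !lorentzDr !lorentzNr !lorentzZr !gl.
have v'v' : lorentz v' v' = lorentz v v.
  rewrite /v' vE !lorentzDr !lorentzDl !lorentzNr !lorentzNl !lorentzZr !lorentzZl.
  by rewrite !gl.
exists v'; first by rewrite v'v'.
split.
- move=> y hy; have [x hx gx] := gs _ hy; rewrite -gx v'E//; split.
    move=> [z + gz].
    case=> [[|]|].
    + move=> [hz zv]; have : z = x.
        by apply: gi; rewrite ?inE// gz.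
      by move=> <-.
    + move=> [z' [hz' zv] zz']; exfalso.
      apply: (hyp_not_neg (gh _ hz')); rewrite -gN// zz' gz gx //.
    + move=> [hz _]; exfalso; apply: (hyp_not_boundary hy).
      by rewrite -gx -gz; exact: gb.
  by move=> xv; exists x => //; left; left.
- move=> y hy; have [x hx gx] := gs _ hy; rewrite -gx v'E//; split.
    move=> [z + gz].
    case=> [[|]|].
    + move=> [hz zv]; exfalso; apply: (hyp_not_neg hy).
      by rewrite -gx -gz; exact: gh.
    + move=> [z' [hz' zv] zz']; have : z' = x.
        by apply: gi; rewrite ?inE//; apply: oppr_inj; rewrite -gz -gN// zz'.
      by move=> <-.
    + move=> [hz _]; exfalso; apply: (hyp_opp_not_boundary hy).
      by rewrite -gx -gz; exact: gb.
  move=> xv; exists (- x); last exact: gN.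
  by left; right; exists x.
- move=> _ [z + <-].
  case=> [[|]|].
  + by move=> [hz _]; constructor 1; exact: gh.
  + by move=> [z' [hz' _] <-]; constructor 2; rewrite gN// opprK; exact: gh.
  + by move=> [hz _]; constructor 3; exact: gb.
Qed.

Lemma DH_isometry_id n : @DH_isometry R n id.
Proof. by split => //; split => [x //|x y _ _ //|x hx]; exists x. Qed.

Lemma DH_setI_half_space n b (v : 'rV[R]_n.+1) :
  @DH R n `&` half_space b v = half_space b v.
Proof.
apply/seteqP; split => [x []//|x hx]; split => //.
case: hx => [[[hx _]|[y [[yy y0] _] <-]]|[hx _]].
- by left; left.
- left; right; split; last by rewrite mxE oppr_lt0.
  by rewrite lorentzNl lorentzNr opprK.
- by right.
Qed.

Lemma lteif_neg b (a : R) : (- a < 0 ?<= if ~~ b) = ~~ (a < 0 ?<= if b).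
Proof. by case: b => /=; rewrite ?oppr_lt0 ?oppr_le0 ?ltNge ?leNgt ?negbK. Qed.

Lemma DH_setD_half_space n b (v : 'rV[R]_n.+1) :
  @DH R n `\` half_space b v = half_space (~~ b) (- v).
Proof.
apply/seteqP; split => x.
  move=> [[[hx|[xx x0]]|hx] nH].
  - left; left; split => //; rewrite lorentzNr lteif_neg; apply/negP => xv.
    by apply: nH; left; left.
  - left; right; exists (- x); last exact: opprK.
    have hx : hyp (- x).
      by split; rewrite ?lorentzNl ?lorentzNr ?opprK// mxE oppr_gt0.
    split => //; rewrite lorentzNr lteif_neg; apply/negP => xv.
    by apply: nH; left; right; exists (- x); rewrite ?opprK.
  - right; split => //; rewrite lorentzNr lteif_neg; apply/negP => xv.
    by apply: nH; right.
move=> hx; split.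
  have : (@DH R n `&` half_space (~~ b) (- v)) x by rewrite DH_setI_half_space.
  by case.
case: hx => [[[hx]|[y [hy + <-]]]|[hx]];
    rewrite lorentzNr lteif_neg => /negP xv [[[hz zv]|[z [hz zv] zE]]|[hz zv]] //.
- by apply: (hyp_not_neg hz); rewrite zE.
- exact: (hyp_not_neg hy hz).
- by apply: xv; rewrite -(oppr_inj zE).
- exact: (hyp_opp_not_boundary hy hz).
- by apply: (hyp_opp_not_boundary hz); rewrite zE.
Qed.

End Lorentz.

(** * Half-spaces in the upper half-space model *)

Section UpperHalfSpace.
Context {R : realType} (m : nat).
Local Notation T m := (m.-tuple (measurableTypeR R)).
Implicit Types (x v : 'rV[R]_m.+2) (t : 'rV[R]_m.+1).

(** The coordinates of index 1, ..., n-1 of R^(n+1), n = m+1: the coordinate 0 is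
    time and the last one is the axis of the stereographic projection. *)
Definition middle (k : 'I_m) : 'I_m.+2 := lift ord0 (widen_ord (leqnSn m) k).

Lemma lorentz_split x v : lorentz x v = - (x 0 0 * v 0 0) +
  \sum_(k < m) x 0 (middle k) * v 0 (middle k) + x 0 ord_max * v 0 ord_max.
Proof.
rewrite /lorentz big_ord_recr/= addrA.
by rewrite (_ : lift ord0 ord_max = ord_max)//; exact: val_inj.
Qed.

Lemma sqnorm_split t :
  sqnorm t = t 0 0 ^+ 2 + \sum_(k < m) t 0 (lift ord0 k) ^+ 2.
Proof. by rewrite /sqnorm big_ord_recl. Qed.

(** In the light-cone coordinates x_0 - x_n and x_0 + x_n, the equation x.x = -1 has
    this form; it prevents x_0 + x_n, the denominator of the stereographic
    projection, from vanishing on both sheets. *)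
Lemma light_coord x : lorentz x x = -1 ->
  (x 0 0 - x 0 ord_max) * (x 0 0 + x 0 ord_max) =
  1 + \sum_(k < m) x 0 (middle k) ^+ 2.
Proof.
rewrite lorentz_split => xx.
transitivity (- (- (x 0 0 * x 0 0) + x 0 ord_max * x 0 ord_max)); first by ring.
rewrite -[1]opprK -xx.
under [X in _ = _ + X]eq_bigr do rewrite expr2.
by ring.
Qed.

Lemma light_coord_gt0 x : lorentz x x = -1 ->
  0 < (x 0 0 - x 0 ord_max) * (x 0 0 + x 0 ord_max).
Proof.
move=> /light_coord ->; rewrite ltr_wpDr//.
by apply: sumr_ge0 => k _; exact: sqr_ge0.
Qed.

Lemma hyp_light_gt0 x : hyp x -> 0 < x 0 0 + x 0 ord_max.
Proof. by move=> [/light_coord_gt0 h x0]; nra. Qed.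

Lemma light_neq0 x : lorentz x x = -1 -> x 0 0 + x 0 ord_max != 0.
Proof. by move=> /light_coord_gt0; apply: contraTneq => ->; rewrite mulr0 ltxx. Qed.

Lemma hyp_neq0 x : lorentz x x = -1 -> x 0 0 != 0.
Proof.
move=> /light_coord_gt0; apply: contraTneq => ->; rewrite sub0r add0r mulNr.
by rewrite oppr_gt0 -leNgt -expr2 sqr_ge0.
Qed.

Lemma to_sphere0 x : lorentz x x = -1 -> to_sphere x 0 0 = (x 0 0)^-1.
Proof. by move=> xx; rewrite mxE eqxx xx oppr_eq0 oner_eq0. Qed.

Lemma to_sphereS x j : j != 0 -> to_sphere x 0 j = x 0 j / x 0 0.
Proof. by move=> /negbTE j0; rewrite mxE j0. Qed.

Lemma upper_coord0 x : lorentz x x = -1 ->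
  upper_coord x 0 0 = 2 / (x 0 0 + x 0 ord_max).
Proof.
move=> xx; have x0 := hyp_neq0 xx; have w0 := light_neq0 xx.
rewrite mxE (_ : widen_ord _ _ = 0); last exact: val_inj.
rewrite to_sphere0// to_sphereS//; field.
by rewrite x0 w0.
Qed.

Lemma upper_coordS x k : lorentz x x = -1 ->
  upper_coord x 0 (lift ord0 k) = 2 * x 0 (middle k) / (x 0 0 + x 0 ord_max).
Proof.
move=> xx; have x0 := hyp_neq0 xx; have w0 := light_neq0 xx.
rewrite mxE (_ : widen_ord _ _ = middle k); last exact: val_inj.
rewrite !to_sphereS//; field.
by rewrite x0 w0.
Qed.

Lemma sqnorm_upper_coord x : lorentz x x = -1 ->
  sqnorm (upper_coord x) = 4 * (x 0 0 - x 0 ord_max) / (x 0 0 + x 0 ord_max).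
Proof.
move=> xx; have w0 := light_neq0 xx.
rewrite sqnorm_split upper_coord0//.
under eq_bigr do rewrite upper_coordS// -mulrA mulrCA exprMn.
rewrite -mulr_suml.
have -> : \sum_(k < m) x 0 (middle k) ^+ 2 =
   (x 0 0 - x 0 ord_max) * (x 0 0 + x 0 ord_max) - 1.
  by rewrite light_coord// addrAC subrr add0r.
by field.
Qed.

(** The equation of the hyperplane orthogonal to v in the upper half-space model,
    cleared of denominators; see quadric_upper_coord. *)
Definition quadric v t : R := - (v 0 0 + v 0 ord_max) * sqnorm t +
  4 * \sum_(k < m) t 0 (lift ord0 k) * v 0 (middle k) + 4 * (v 0 ord_max - v 0 0).

(** The first upper coordinate is positive on H^n and negative on its antipode,
    so that the same quadric bounds both parts of a half-space. *)
Lemma quadric_upper_coord x v : lorentz x x = -1 ->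
  quadric v (upper_coord x) = 4 * upper_coord x 0 0 * lorentz x v.
Proof.
move=> xx; have w0 := light_neq0 xx.
rewrite /quadric sqnorm_upper_coord// upper_coord0// lorentz_split.
have -> : \sum_(k < m) upper_coord x 0 (lift ord0 k) * v 0 (middle k) =
    2 / (x 0 0 + x 0 ord_max) * \sum_(k < m) x 0 (middle k) * v 0 (middle k).
  by rewrite mulr_sumr; apply: eq_bigr => k _; rewrite upper_coordS//; ring.
by field.
Qed.

(** The inverse of upper_coord away from the boundary, by from_upperK; it reaches
    H^n or its antipode according to the sign of t_0. *)
Definition from_upper t : 'rV[R]_m.+2 := \row_j
  (if j == 0 then (4 + sqnorm t) / (4 * t 0 0) else
   if unlift ord_max j is Some i then t 0 i / t 0 0
   else (4 - sqnorm t) / (4 * t 0 0)).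

Lemma from_upper0 t : from_upper t 0 0 = (4 + sqnorm t) / (4 * t 0 0).
Proof. by rewrite mxE eqxx. Qed.

Lemma from_upper_max t : from_upper t 0 ord_max = (4 - sqnorm t) / (4 * t 0 0).
Proof. by rewrite mxE unlift_none. Qed.

Lemma from_upper_middle t k : from_upper t 0 (middle k) = t 0 (lift ord0 k) / t 0 0.
Proof.
rewrite mxE/= (_ : middle k = lift ord_max (lift ord0 k)) ?liftK//.
by apply: val_inj; rewrite /= /bump/= add1n ltnS leqNgt ltn_ord.
Qed.

Lemma lorentz_from_upper t : t 0 0 != 0 -> lorentz (from_upper t) (from_upper t) = -1.
Proof.
move=> t0; rewrite lorentz_split from_upper0 from_upper_max.
under eq_bigr do rewrite from_upper_middle -expr2 expr_div_n.
rewrite -mulr_suml.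
have -> : \sum_(k < m) t 0 (lift ord0 k) ^+ 2 = sqnorm t - t 0 0 ^+ 2.
  by rewrite sqnorm_split addrAC subrr add0r.
by field.
Qed.

Lemma from_upperK t : t 0 0 != 0 -> upper_coord (from_upper t) = t.
Proof.
move=> t0; have xx := lorentz_from_upper t0.
have w : from_upper t 0 0 + from_upper t 0 ord_max = 2 / t 0 0.
  by rewrite from_upper0 from_upper_max; field.
apply/rowP => j; case: (unliftP ord0 j) => [k ->|->].
  by rewrite upper_coordS// w from_upper_middle; field.
by rewrite upper_coord0// w; field.
Qed.

Lemma sqnorm_ge0 t : 0 <= sqnorm t.
Proof. by apply: sumr_ge0 => j _; exact: sqr_ge0. Qed.

Lemma hyp_from_upper t : 0 < t 0 0 -> hyp (from_upper t).
Proof.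
move=> t0; split; first by rewrite lorentz_from_upper// gt_eqF.
by rewrite from_upper0 divr_gt0 ?mulr_gt0// ltr_wpDr ?sqnorm_ge0.
Qed.

Lemma hyp_opp_from_upper t : t 0 0 < 0 -> hyp (- from_upper t).
Proof.
move=> t0; split; first by rewrite lorentzNl lorentzNr opprK lorentz_from_upper// lt_eqF.
rewrite mxE oppr_gt0 from_upper0 pmulr_rlt0 ?ltr_wpDr ?sqnorm_ge0//.
by rewrite invr_lt0 pmulr_rlt0.
Qed.

(** Points with first coordinate 0 are excluded because they are the points at
    infinity. *)
Lemma upper_region_quadric P b v (s : T m.+1) : half_space_like P b v ->
  thead s <> 0 ->
  upper_region P s <-> quadric v (row_of_tuple s) < 0 ?<= if b.
Proof.
move=> [Pp Pn Pb] s0; set t := row_of_tuple s.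
have ts : t 0 0 = thead s by rewrite mxE.
have t0 : t 0 0 != 0 by rewrite ts; apply/eqP.
have pos (a c : R) : 0 < a -> (a * c < 0 ?<= if b) = (c < 0 ?<= if b).
  by move=> a0; case: b {Pp Pn} => /=; [rewrite pmulr_rle0|rewrite pmulr_rlt0].
have key x : lorentz x x = -1 -> upper_coord x = t ->
    (quadric v t < 0 ?<= if b) = (t 0 0 * lorentz x v < 0 ?<= if b).
  by move=> xx xt; rewrite -xt quadric_upper_coord// -mulrA pos.
have hyp_sign x : hyp x -> 0 < upper_coord x 0 0.
  by move=> hx; have [xx _] := hx; rewrite upper_coord0// divr_gt0// hyp_light_gt0.
split.
  move=> [x Px]; rewrite -/t => xt.
  have [hx|hx|[xx x1]] := Pb _ Px.
  - have [xx _] := hx; rewrite (key x)// pos; last by rewrite -xt hyp_sign.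
    exact/Pp.
  - have [xx _] := hx.
    have xx' : lorentz x x = -1 by move: xx; rewrite lorentzNl lorentzNr opprK.
    have tn : 0 < - t 0 0.
      have hw := hyp_light_gt0 hx; rewrite !mxE -opprD oppr_gt0 in hw.
      by rewrite -xt upper_coord0// oppr_gt0 pmulr_rlt0// invr_lt0.
    rewrite (key x)// -mulrNN pos// -lorentzNl; apply/Pn => //.
    by rewrite opprK.
  - exfalso; move/eqP: t0; apply; rewrite -xt mxE (_ : widen_ord _ _ = 0); last exact: val_inj.
    by rewrite [to_sphere x 0 0]mxE eqxx xx eqxx mulr0 mul0r.
move=> q; exists (from_upper t); last by rewrite from_upperK.
have xx := lorentz_from_upper t0; have xt := from_upperK t0.
have [tn|tp|/eqP] := ltgtP (t 0 0) 0; last by rewrite (negbTE t0).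
  have hx := hyp_opp_from_upper tn; rewrite -[from_upper t]opprK; apply/Pn => //.
  by move: q; rewrite (key _ xx xt) lorentzNl -mulrNN pos ?oppr_gt0.
have hx := hyp_from_upper tp; apply/Pp => //.
by move: q; rewrite (key _ xx xt) pos.
Qed.

End UpperHalfSpace.

(** * Bounded half-spaces are balls *)

Section HalfSpaceVolume.
Context {R : realType} (m : nat).
Local Notation T m := (m.-tuple (measurableTypeR R)).
Implicit Types (x v : 'rV[R]_m.+2) (t : 'rV[R]_m.+1).

Lemma lorentz_self_split v : lorentz v v =
  \sum_(k < m) v 0 (middle k) ^+ 2 +
  (v 0 ord_max - v 0 0) * (v 0 0 + v 0 ord_max).
Proof. by rewrite lorentz_split; under eq_bigr do rewrite -expr2; ring. Qed.

(** If v_0 + v_n > 0 the region is the outside of a ball and contains the far points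
    of the vertical axis.  If v_0 + v_n = 0 it is a Euclidean half-space, because the
    middle part of v is not 0, and it is unbounded in the direction opposite to
    that part. *)
Lemma quadric_unbounded v (M : R) : 0 < lorentz v v -> 0 <= v 0 0 + v 0 ord_max ->
  exists t, [/\ 0 < t 0 0, quadric v t < 0 & M < sqnorm t].
Proof.
move=> v0; rewrite le_eqVlt => /orP[/eqP b0|b0].
  pose S := \sum_(k < m) v 0 (middle k) ^+ 2.
  have S0 : 0 < S by move: v0; rewrite lorentz_self_split -b0 mulr0 addr0.
  (* A >= 1, and A S exceeds both - 2 v_0 and M, the bounds needed below *)
  pose A := 1 + (2 * `|v 0 0| + `|M|) / S.
  have A1 : 1 <= A by rewrite lerDl divr_ge0 ?addr_ge0 ?mulr_ge0 ?normr_ge0 ?(ltW S0).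
  have AS : A * S = S + 2 * `|v 0 0| + `|M|.
    by rewrite /A; field; rewrite gt_eqF.
  pose t : 'rV[R]_m.+1 := \row_j
    (if unlift ord0 j is Some k then - (A * v 0 (middle k)) else 1).
  have t0 : t 0 0 = 1 by rewrite mxE unlift_none.
  have tk k : t 0 (lift ord0 k) = - (A * v 0 (middle k)) by rewrite mxE liftK.
  have v1 := ler_norm (- v 0 0); rewrite normrN in v1.
  have M1 := ler_norm M.
  have vm := normr_ge0 (v 0 0).
  have Mm := normr_ge0 M.
  exists t; split; first by rewrite t0.
  - rewrite /quadric -b0 oppr0 mul0r add0r.
    under eq_bigr do rewrite tk mulNr -mulrA -expr2.
    rewrite sumrN -mulr_sumr -/S AS.
    have -> : v 0 ord_max = - v 0 0 by apply/eqP; rewrite -addr_eq0 addrC -b0.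
    lra.
  - rewrite sqnorm_split t0; under eq_bigr do rewrite tk sqrrN exprMn.
    rewrite -mulr_sumr -/S expr1n expr2 -mulrA AS.
    have : 1 * (S + 2 * `|v 0 0| + `|M|) <= A * (S + 2 * `|v 0 0| + `|M|).
      by apply: ler_wpM2r => //; lra.
    lra.
pose b := v 0 0 + v 0 ord_max.
pose K := 4 * `|v 0 ord_max - v 0 0|.
(* A >= 1 gives A^2 >= A, and b A exceeds K *)
pose A := 1 + `|M| + K / b.
have K0 : 0 <= K by rewrite mulr_ge0 ?normr_ge0.
have Kb : 0 <= K / b by rewrite divr_ge0 ?(ltW b0).
have Mm := normr_ge0 M; have M1 := ler_norm M.
have A1 : 1 <= A by rewrite /A; lra.
have AA : A <= A ^+ 2 by rewrite expr2 ler_peMl// (le_trans ler01).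
exists (A *: delta_mx 0 0).
have t0 : (A *: delta_mx 0 0 : 'rV[R]_m.+1) 0 0 = A by rewrite !mxE eqxx mulr1.
have tk k : (A *: delta_mx 0 0 : 'rV[R]_m.+1) 0 (lift ord0 k) = 0 by rewrite !mxE mulr0.
have q : sqnorm (A *: delta_mx 0 0 : 'rV[R]_m.+1) = A ^+ 2.
  by rewrite sqnorm_split t0 big1 ?addr0// => k _; rewrite tk expr0n.
split; first by rewrite t0 (lt_le_trans ltr01).
- rewrite /quadric q -/b big1; last by move=> k _; rewrite tk mul0r.
  rewrite mulr0 addr0.
  have : b * A <= b * A ^+ 2 by rewrite ler_pM2l.
  have -> : b * A = b + b * `|M| + K by rewrite /A; field; rewrite gt_eqF.
  have := ler_norm (v 0 ord_max - v 0 0).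
  have : 0 <= b * `|M| by rewrite mulr_ge0 ?(ltW b0).
  rewrite /K -/b in b0 *; lra.
- rewrite q; apply: lt_le_trans AA; rewrite /A; lra.
Qed.

Lemma upper_bounded_normal (P : set 'rV[R]_m.+2) v :
  (forall x, hyp x -> lorentz x v < 0 -> P x) ->
  0 < lorentz v v -> upper_bounded P -> v 0 0 + v 0 ord_max < 0.
Proof.
move=> vP v0 [_ [M PM]].
rewrite ltNge; apply/negP => b0.
have [t [t0 q tM]] := quadric_unbounded M v0 b0.
have hx := hyp_from_upper t0; have [xx _] := hx.
have tE : upper_coord (from_upper t) = t by rewrite from_upperK// gt_eqF.
have xv : lorentz (from_upper t) v < 0.
  move: q; rewrite -[in quadric _ _]tE quadric_upper_coord// tE.
  by rewrite pmulr_rlt0// mulr_gt0.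
have := PM (from_upper t); rewrite tE leNgt tM => /(_ _)/negP; apply => //.
exact: vP.
Qed.

Definition half_space_center v : T m :=
  [tuple 2 * v 0 (middle k) / (v 0 0 + v 0 ord_max) | k < m].

Definition half_space_radius v : R :=
  2 * Num.sqrt (lorentz v v) / - (v 0 0 + v 0 ord_max).

(** Completing the square.  The centre has first coordinate 0 since t_0 occurs in
    the quadric only through |t|^2. *)
Lemma quadric_tball b v (s : T m.+1) : 0 < lorentz v v ->
  v 0 0 + v 0 ord_max < 0 ->
  (quadric v (row_of_tuple s) < 0 ?<= if b) <->
  tball b (tuple_cons (0, half_space_center v)) (half_space_radius v ^+ 2) s.
Proof.
move=> v0 w0; rewrite /tball/=.
set a := - (v 0 0 + v 0 ord_max).
have a0 : 0 < a by rewrite oppr_gt0.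
have w1 : v 0 0 + v 0 ord_max != 0 by rewrite lt_eqF.
have -> : quadric v (row_of_tuple s) =
    a * (\sum_(j < m.+1) (tnth s j - tnth (tuple_cons (0 : R, half_space_center v)) j) ^+ 2 -
         half_space_radius v ^+ 2).
  rewrite /quadric sqnorm_split big_ord_recl tnth0 mxE.
  have -> : half_space_radius v ^+ 2 = 4 * lorentz v v / a ^+ 2.
    rewrite /half_space_radius expr_div_n exprMn sqr_sqrtr ?(ltW v0)// -/a.
    by congr (_ * _ / _); ring.
  rewrite lorentz_self_split.
  have -> : \sum_(k < m) (tnth s (lift ord0 k) -
        tnth (tuple_cons (0 : R, half_space_center v)) (lift ord0 k)) ^+ 2 =
     \sum_(k < m) row_of_tuple s 0 (lift ord0 k) ^+ 2 +
     4 / a * (\sum_(k < m) row_of_tuple s 0 (lift ord0 k) * v 0 (middle k)) +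
     4 / a ^+ 2 * \sum_(k < m) v 0 (middle k) ^+ 2.
    rewrite !mulr_sumr -!big_split/=; apply: eq_bigr => k _.
    rewrite tnthS tnth_mktuple mxE /a; field.
    by rewrite w1.
  rewrite subr0 -/a.
  have -> : v 0 0 + v 0 ord_max = - a by rewrite opprK.
  by clearbody a; field; rewrite gt_eqF.
by case: b => /=; rewrite ?pmulr_rle0 ?pmulr_rlt0// ?subr_le0 ?subr_lt0.
Qed.

End HalfSpaceVolume.

(** * The volume of a half-space *)

Section DoubleHyperbolicVolume.
Context {R : realType} (m : nat).
Local Notation C := (R[i] : numFieldType).
Implicit Types (x v : 'rV[R]_m.+2) (t : 'rV[R]_m.+1).

(** The common volume of all half-spaces of DH^(m+1). *)
Definition half_volume : R[i] := 'i ^+ m.+1 * (pi * @ball_volume R m)%:C.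

Lemma half_space_like_volume P b v : half_space_like P b v ->
  0 < lorentz v v -> upper_bounded P ->
  regularized_integral P eps @[eps --> 0^'+] --> (half_volume : C).
Proof.
move=> Pv v0 bP; have [Pp _ _] := Pv.
have w0 : v 0 0 + v 0 ord_max < 0.
  apply: (upper_bounded_normal _ v0 bP) => x hx xv; apply/Pp => //.
  by case: (b); rewrite //= ltW.
apply: (@complex_integral_tball_limit R m _ b (half_space_center v) (half_space_radius v)).
  by rewrite divr_gt0 ?oppr_gt0// mulr_gt0// sqrtr_gt0.
move=> s s0; rewrite -(quadric_tball b s v0 w0).
exact: upper_region_quadric.
Qed.

(** The limit is unique, and half_space_like_volume gives its value whatever g
    is. *)
Lemma bounded_volume_isometry (g : 'rV[R]_m.+2 -> 'rV[R]_m.+2) b v w :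
  DH_isometry g -> 0 < lorentz v v -> bounded_volume (g @` half_space b v) w ->
  w = half_volume.
Proof.
move=> ig v0 [bP lw]; have [v' v'0 Pv] := isometry_half_space b ig v0.
have lh := half_space_like_volume Pv v'0 bP.
have H : hausdorff_space C by exact: norm_hausdorff.
exact: (cvg_unique H lw lh).
Qed.

Lemma isometry_bounded_volume (g : 'rV[R]_m.+2 -> 'rV[R]_m.+2) b v :
  DH_isometry g -> 0 < lorentz v v -> upper_bounded (g @` half_space b v) ->
  bounded_volume (g @` half_space b v) half_volume.
Proof.
move=> ig v0 bP; have [v' v'0 Pv] := isometry_half_space b ig v0.
by split => //; exact: half_space_like_volume Pv v'0 bP.
Qed.

Lemma movable_volume_half_space b v w : 0 < lorentz v v ->
  movable_volume (half_space b v) w -> w = half_volume.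
Proof.
move=> v0 [bw|[_ [g ig bw]]]; last exact: bounded_volume_isometry ig v0 bw.
by apply: (bounded_volume_isometry (@DH_isometry_id R _) v0); rewrite image_id; exact: bw.
Qed.

Lemma middle_neq_max (k : 'I_m) : middle k != ord_max.
Proof. by rewrite -val_eqE/= /bump/= add1n neq_ltn ltnS ltn_ord. Qed.

Lemma hyp_unbounded (P : set 'rV[R]_m.+2) : @hyp R m.+1 `<=` P -> ~ upper_bounded P.
Proof.
move=> hP bP; pose e : 'rV[R]_m.+2 := delta_mx 0 ord_max.
have e0 : e 0 0 = 0 by rewrite mxE.
have em : e 0 ord_max = 1 by rewrite mxE !eqxx.
have ee : 0 < lorentz e e.
  rewrite lorentz_self_split e0 em big1 => [|k _]; first by lra.
  by rewrite mxE (negbTE (middle_neq_max k)) expr0n.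
have := @upper_bounded_normal R m P e _ ee bP.
by rewrite e0 em add0r ltr10 => /(_ (fun x hx _ => hP x hx)).
Qed.

(** The image of DH under an isometry still contains H^n. *)
Lemma DH_not_movable : ~ movable (@DH R m.+1).
Proof.
move=> [g [[gh gi gs] _ _ _ _]]; apply: hyp_unbounded => y hy.
by have [x hx <-] := gs _ hy; exists x => //; left; left.
Qed.

Lemma DH_not_movable_volume w : ~ movable_volume (@DH R m.+1) w.
Proof.
move=> [[bP _]|[_ [g ig [bP _]]]]; apply: DH_not_movable.
  by exists id; [exact: DH_isometry_id|rewrite image_id].
by exists g.
Qed.

(** The isometry that exchanges the two hemispheres x_n >= 0 and x_n <= 0 of the
    sphere model, hence the inside and the outside of a ball of the upper
    half-space model. *)
Definition reflection x : 'rV[R]_m.+2 :=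
  x - (2 * x 0 ord_max) *: delta_mx 0 ord_max.

Lemma reflection_max x : reflection x 0 ord_max = - x 0 ord_max.
Proof. by rewrite !mxE !eqxx/=; ring. Qed.

Lemma reflection_neq x j : j != ord_max -> reflection x 0 j = x 0 j.
Proof. by move=> jm; rewrite !mxE (negbTE jm) mulr0 subr0. Qed.

Lemma reflectionK : involutive reflection.
Proof.
move=> x; apply/rowP => j; have [->|jm] := eqVneq j ord_max.
  by rewrite !reflection_max opprK.
by rewrite !reflection_neq.
Qed.

Lemma lorentz_reflection x y : lorentz (reflection x) (reflection y) = lorentz x y.
Proof.
rewrite !lorentz_split !reflection_max !(@reflection_neq _ 0)// mulrNN.
congr (_ + _ + _); apply: eq_bigr => k _.
by rewrite !reflection_neq ?middle_neq_max.
Qed.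

Lemma reflection_to_sphere x :
  to_sphere (reflection x) = reflection (to_sphere x).
Proof.
apply/rowP => j; have [->|jm] := eqVneq j ord_max.
  by rewrite reflection_max !to_sphereS// reflection_max reflection_neq// mulNr.
rewrite reflection_neq//; have [->|j0] := eqVneq j 0.
  by rewrite [LHS]mxE [RHS]mxE eqxx lorentz_reflection reflection_neq.
by rewrite !to_sphereS// !reflection_neq.
Qed.

Lemma reflection_continuous : continuous reflection.
Proof.
move=> x.
apply: (@cvgB _ _ _ _ (nbhs_filter x) id (fun x => (2 * x 0 ord_max) *: delta_mx 0 ord_max)).
  exact: cvg_id.
apply: cvgZr_tmp; apply: cvgM; first exact: cvg_cst.
exact: coord_continuous.
Qed.

Lemma hyp_reflection x : hyp x -> hyp (reflection x).
Proof. by move=> [xx x0]; split; rewrite ?lorentz_reflection// reflection_neq. Qed.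

(** The condition at infinity holds because the reflection commutes with to_sphere
    and is continuous. *)
Lemma DH_isometry_reflection : DH_isometry reflection.
Proof.
split.
- split; first exact: hyp_reflection.
  + by move=> x y _ _; exact: (can_inj reflectionK).
  + by move=> x hx; exists (reflection x); [exact: hyp_reflection|exact: reflectionK].
- by move=> x y _ _; rewrite /hyp_dist lorentz_reflection.
- move=> x _; apply/rowP => j; have [->|jm] := eqVneq j ord_max.
    by rewrite [RHS]mxE !reflection_max mxE.
  by rewrite [RHS]mxE !reflection_neq// mxE.
- by move=> p [pp p0]; split; rewrite ?lorentz_reflection// reflection_neq.
- move=> p u _ _ up; rewrite reflection_to_sphere.
  under eq_fun do rewrite reflection_to_sphere.
  apply: (@cvg_comp _ _ _ (fun k => to_sphere (u k)) reflection _ _ _ up).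
  exact: reflection_continuous.
Qed.

End DoubleHyperbolicVolume.

(** * A cut of DH^n into two movable pieces *)

Section Existence.
Context {R : realType} (m : nat).
Implicit Types (x v : 'rV[R]_m.+2) (t : 'rV[R]_m.+1).

Lemma DH_time_neq0 x : DH x -> x 0 0 != 0.
Proof.
case=> [[[_ x0]|[_ x0]]|[_ ->]]; [exact: lt0r_neq0|exact: ltr0_neq0|exact: oner_neq0].
Qed.

Lemma to_sphere_unit x : DH x ->
  to_sphere x 0 0 ^+ 2 + \sum_(k < m) to_sphere x 0 (middle k) ^+ 2 +
  to_sphere x 0 ord_max ^+ 2 = 1.
Proof.
move=> Dx; have x0 := DH_time_neq0 Dx.
have -> : to_sphere x 0 0 ^+ 2 = - lorentz x x / x 0 0 ^+ 2.
  case: Dx => [[[xx _]|[xx _]]|[xx _]].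
  - by rewrite to_sphere0// xx opprK mul1r exprVn.
  - by rewrite to_sphere0// xx opprK mul1r exprVn.
  - by rewrite mxE eqxx xx eqxx oppr0 mul0r expr0n.
under eq_bigr do rewrite to_sphereS// expr_div_n.
rewrite -mulr_suml to_sphereS// lorentz_self_split; field.
exact: x0.
Qed.

(** The stereographic projection from the south pole maps the northern hemisphere
    into the ball of radius 2. *)
Lemma sqnorm_upper_coord_le x : DH x -> 0 <= to_sphere x 0 ord_max ->
  sqnorm (upper_coord x) <= 4.
Proof.
move=> Dx s0; have D0 : 0 < to_sphere x 0 ord_max + 1 by rewrite ltr_wpDl.
have -> : sqnorm (upper_coord x) =
    4 * (1 - to_sphere x 0 ord_max ^+ 2) / (to_sphere x 0 ord_max + 1) ^+ 2.
  have u0 : upper_coord x 0 0 = 2 * to_sphere x 0 0 / (to_sphere x 0 ord_max + 1).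
    by rewrite mxE; congr (2 * to_sphere x _ _ / _); exact: val_inj.
  have uS k : upper_coord x 0 (lift ord0 k) =
      2 / (to_sphere x 0 ord_max + 1) * to_sphere x 0 (middle k).
    by rewrite mxE mulrAC; congr (_ * to_sphere x _ _); exact: val_inj.
  rewrite sqnorm_split u0; under eq_bigr do rewrite uS exprMn.
  rewrite -mulr_sumr.
  have -> : \sum_(k < m) to_sphere x 0 (middle k) ^+ 2 =
      1 - to_sphere x 0 0 ^+ 2 - to_sphere x 0 ord_max ^+ 2.
    by rewrite -(to_sphere_unit Dx); ring.
  by field; rewrite gt_eqF.
rewrite ler_pdivrMr ?exprn_gt0//.
have := sqr_ge0 (to_sphere x 0 ord_max); nra.
Qed.

Lemma upper_bounded_hemisphere (P : set 'rV[R]_m.+2) :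
  (forall x, P x -> DH x /\ 0 <= to_sphere x 0 ord_max) -> upper_bounded P.
Proof.
move=> PD; split.
  move=> x Px; have [_ s0] := PD _ Px; rewrite /at_infinity => sx.
  by move: s0; rewrite sx ler0N1.
by exists 4 => x Px; have [Dx s0] := PD _ Px; exact: sqnorm_upper_coord_le.
Qed.

(** The half-space {x.v <= 0} with this normal vector is {x_n >= 0}, the northern
    hemisphere. *)
Definition north : 'rV[R]_m.+2 := - delta_mx 0 ord_max.

Lemma lorentz_north x : lorentz x north = - x 0 ord_max.
Proof.
rewrite /north lorentzNr lorentz_split !mxE !eqxx/= big1 => [|k _]; first by ring.
by rewrite mxE (negbTE (middle_neq_max k)) mulr0.
Qed.

Lemma north_spacelike : 0 < lorentz north north.
Proof. by rewrite lorentz_north !mxE !eqxx opprK ltr01. Qed.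

(** The last coordinate on the sphere is a quotient, so that antipodal points have
    the same one and y can be chosen in the future cone. *)
Lemma half_space_hemisphere b v x : half_space b v x ->
  exists y : 'rV[R]_m.+2, [/\ x 0 ord_max / x 0 0 = y 0 ord_max / y 0 0, 0 < y 0 0 &
    lorentz y v < 0 ?<= if b].
Proof.
case=> [[[[xx x0] xv]|[y [[yy y0] yv] <-]]|[[xx x1] xv]].
- by exists x.
- by exists y; split => //; rewrite !mxE invrN mulrNN.
- by exists x; split => //; rewrite x1.
Qed.

Lemma half_space_DH b v : half_space b v `<=` @DH R m.+1.
Proof. by rewrite -(DH_setI_half_space b v) => x []. Qed.

Lemma upper_bounded_north : upper_bounded (half_space true north).
Proof.
apply: upper_bounded_hemisphere => x hx; split; first exact: half_space_DH hx.
have [y [xy y0 /=]] := half_space_hemisphere hx; rewrite lorentz_north oppr_le0 => yn.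
by rewrite to_sphereS// xy divr_ge0 ?(ltW y0).
Qed.

Lemma DH_reflection x : DH x -> DH (reflection x).
Proof.
by case=> [[[xx x0]|[xx x0]]|[xx x0]]; [left; left|left; right|right]; split;
  rewrite ?lorentz_reflection// reflection_neq.
Qed.

Lemma upper_bounded_south :
  upper_bounded (@reflection R m @` half_space false (- north)).
Proof.
apply: upper_bounded_hemisphere => _ [x hx <-]; split.
  exact: DH_reflection (half_space_DH hx).
have [y [xy y0 /=]] := half_space_hemisphere hx.
rewrite lorentzNr lorentz_north opprK => yn.
rewrite reflection_to_sphere reflection_max to_sphereS// xy oppr_ge0 ltW//.
by rewrite pmulr_llt0 ?invr_gt0.
Qed.

Lemma south_unbounded : ~ upper_bounded (half_space false (- north)).
Proof.
move=> bP; have s0 : 0 < lorentz (- north) (- north).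
  by rewrite lorentzNl lorentzNr opprK north_spacelike.
have := @upper_bounded_normal R m _ _ _ s0 bP.
rewrite !mxE !eqxx/= !opprK add0r ltr10 => /(_ _)/notF; apply => x hx xv.
by left; left.
Qed.

End Existence.

(** * The total volume *)

Section MainTheorem.
Context {R : realType}.

Lemma half_volume_double m :
  half_volume m + half_volume m = 'i ^+ m.+1 * (sphere_volume R m.+1)%:C :> R[i].
Proof. by rewrite sphere_volume_ball mulr2n rmorphD/= mulrDr. Qed.

Lemma DH_half_space_algebra n : half_space_algebra (@DH R n).
Proof. by apply: sub_gen_smallest; right. Qed.

(** The northern hemisphere is bounded; the southern one is not, and becomes so by
    reflection. *)
Lemma is_volume_DH m : is_volume (@DH R m.+1) (half_volume m + half_volume m).
Proof.
have s0 : 0 < lorentz (- @north R m) (- @north R m).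
  by rewrite lorentzNl lorentzNr opprK north_spacelike.
split; first exact: DH_half_space_algebra.
right; split; first exact: DH_not_movable.
exists (half_space true (@north R m)), (half_volume m), (half_volume m); split => //.
- by exists true, (@north R m); split => //; exact: north_spacelike.
- rewrite DH_setI_half_space; left; rewrite -[half_space _ _]image_id.
  apply: isometry_bounded_volume; [exact: DH_isometry_id|exact: north_spacelike|].
  by rewrite image_id; exact: upper_bounded_north.
- rewrite DH_setD_half_space; right; split; first exact: south_unbounded.
  exists (@reflection R m); first exact: DH_isometry_reflection.
  apply: isometry_bounded_volume => //; first exact: DH_isometry_reflection.
  exact: upper_bounded_south.
Qed.

(** A cut by any half-space leaves two half-spaces, by DH_setI_half_space and
    DH_setD_half_space, and each has volume half_volume for every choice of the
    isometries. *)
Lemma is_volume_DH_unique m v : is_volume (@DH R m.+1) v ->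
  v = half_volume m + half_volume m.
Proof.
move=> [_ [/DH_not_movable_volume//|[_ [H [v1 [v2 [[b [u [u0 ->]]] + + ->]]]]]]].
rewrite DH_setI_half_space DH_setD_half_space.
move=> /(movable_volume_half_space u0) -> /movable_volume_half_space -> //.
by rewrite lorentzNl lorentzNr opprK.
Qed.

Lemma DH0E : @DH R 0 = [set 1%:M; - 1%:M].
Proof.
have eqx (x : 'rV[R]_1) (a : R) : x 0 0 = a -> x = a%:M.
  by move=> xa; rewrite [x]mx11_scalar xa.
have lx (x : 'rV[R]_1) : lorentz x x = - x 0 0 ^+ 2 by rewrite lorentz_self big_ord0 addr0.
apply/seteqP; split => x.
  case=> [[[]|[]]|[]]; rewrite lx.
  - move=> /eqP; rewrite eqr_opp sqrf_eq1 => /orP[/eqP x1|/eqP ->].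
      by move=> _; left; exact: eqx.
    by rewrite ltr0N1.
  - move=> /eqP; rewrite eqr_opp sqrf_eq1 => /orP[/eqP ->|/eqP x1 _].
      by rewrite ltr10.
    by right; rewrite (eqx _ _ x1) raddfN.
  - by move=> + x1; rewrite x1 expr1n => /eqP; rewrite oppr_eq0 oner_eq0.
by case=> ->; left; [left|right]; split;
  rewrite ?lx !mxE ?sqrrN ?expr1n ?ltr01 ?oppr_lt0 ?ltr01.
Qed.

Lemma DH0_card : (@DH R 0 #= `I_2)%card.
Proof.
have n1 : (- 1%:M : 'rV[R]_1) != 1%:M.
  apply/eqP => /matrixP/(_ 0 0); rewrite !mxE eqxx mulr1n => h.
  by have := ltr01 (R := R); rewrite -{1}oppr_lt0 h ltNge ler01.
apply/card_set_bijP; exists (fun x : 'rV[R]_1 => if x == 1%:M then 0%N else 1%N).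
rewrite DH0E; split.
- by move=> x _ /=; case: ifP.
- move=> x y; rewrite !inE => -[->|->] [->|->] //=; rewrite eqxx (negbTE n1)//.
- move=> [|[|//]] _; first by exists 1%:M; [left|rewrite eqxx].
  by exists (- 1%:M); [right|rewrite (negbTE n1)].
Qed.

End MainTheorem.

Theorem theorem1p1 (R : realType) (n : nat) (v : R[i]) :
  is_volume (@DH R n) v <-> v = 'i%C ^+ n * (sphere_volume R n)%:C.
Proof.
case: n => [|m].
  rewrite sphere_volume0 expr0 mul1r rmorph_nat; split.
    move=> [_ [k Dk ->]]; congr (_%:R); apply/card_eq_II.
    by rewrite -(card_eql Dk); exact: DH0_card.
  move=> ->; split; first exact: DH_half_space_algebra.
  by exists 2%N; first exact: DH0_card.
rewrite -half_volume_double; split; first exact: is_volume_DH_unique.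
by move=> ->; exact: is_volume_DH.
Qed.
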